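(* Let $C$ be a linear subspace of $L^2_{loc}(G)$ with a seminorm $\|\cdot\|$, and let $\mathcal{A}$ be a van Hove sequence on $G$, such that the following properties hold: (a) To each $f\in C$ there is associated a formal expansion $f\sim\sum_{\chi\in\widehat G}c_\chi\chi$ with $c_\chi=c_\chi(f)\in\mathbb{C}$ such that $\|f\|^2=\sum_{\chi\in\widehat{G}}|c_\chi|^2$. (b) $\widehat{G}\subseteq C$, and each $\chi\in\widehat{G}$ has the formal expansion $\chi\sim\chi$. (c) The formal expansion in (a) is linear in $f$. (d) For all $f\in C$, the reflected Eberlein convolution $h_f$ of $f$ with itself exists with respect to $\mathcal{A}$ and is continuous, and the measure $\gamma_f:=h_f\,\theta_G$ satisfies $\widehat{\gamma_f}=\sum_{\chi\in\widehat{G}}|c_\chi(f)|^2\,\delta_\chi$. Then every $f\in C$ is a Besicovitch $2$-almost periodic function with respect to $\mathcal{A}$, and for each $f\in C$ we have $\|f\|=\|f\|_{\mathsf{B},2,\mathcal{A}}$ and $c_\chi(f)=a_\chi^{\mathcal{A}}(f)$ for all $\chi\in\widehat{G}$. Moreover, if the Riesz--Fischer condition holds in $C$ (for each square summable family $(c_\chi)_{\chi\in\widehat G}$ there is $f\in C$ with $f\sim\sum_\chi c_\chi\chi$), then $C$ equals the space of all Besicovitch $2$-almost periodic functions with respect to $\mathcal{A}$, functions $f,g$ with $\|f-g\|_{\mathsf{B},2,\mathcal{A}}=0$ being identified.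
   Context: $G$ is a locally compact (Hausdorff), $\sigma$-compact abelian group with Haar measure $\theta_G$; $|A|=\theta_G(A)$, and $\mathrm{d}t$ denotes integration against $\theta_G$. $\widehat{G}$ is the dual group. A van Hove sequence $\mathcal{A}=(A_n)$ is a sequence of relatively compact open sets (of positive measure) with $|\partial^K A_n|/|A_n|\to 0$ for every compact $K\subseteq G$, where $\partial^K A=\big(\overline{A+K}\cap\overline{A^c}\big)\cup\big(\overline{A^c-K}\cap\overline{A}\big)$. The reflected Eberlein convolution of $f$ with itself (with respect to $\mathcal{A}$) is the function $h_f(t)=\lim_{n\to\infty}\frac{1}{|A_n|}\int_{A_n}f(s)\,\overline{f(s-t)}\,\mathrm{d}s$, said to exist if the integrals and the limit exist for all $t\in G$. The Fourier transform $\widehat\gamma$ of a positive definite measure $\gamma$ on $G$ is the unique positive measure on $\widehat G$ with $\int_{\widehat G}|\check\varphi|^2\,\mathrm{d}\widehat\gamma=\int_G(\varphi*\widetilde\varphi)\,\mathrm{d}\gamma$ for all $\varphi\in C_c(G)$, where $\check\varphi(\chi)=\int_G\chi(t)\varphi(t)\,\mathrm{d}t$ and $\widetilde\varphi(s)=\overline{\varphi(-s)}$. For $f\in\mathcal{L}^2_{loc}(G)$ put $\|f\|_{\mathsf{B},2,\mathcal{A}}=\limsup_n\big(\frac{1}{|A_n|}\int_{A_n}|f(t)|^2\,\mathrm{d}t\big)^{1/2}$. A function $f\in\mathcal{L}^2_{loc}(G)$ is Besicovitch $2$-almost periodic with respect to $\mathcal{A}$ if for each $\varepsilon>0$ there is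 a trigonometric polynomial $P$ (finite linear combination of characters) with $\|f-P\|_{\mathsf{B},2,\mathcal{A}}<\varepsilon$. The Fourier--Bohr coefficient is $a_\chi^{\mathcal{A}}(f)=\lim_{n}\frac{1}{|A_n|}\int_{A_n}\overline{\chi(t)}f(t)\,\mathrm{d}t$. *)

(* Defs.v *)
From HB Require Import structures.
From mathcomp Require Import all_boot all_order all_algebra.
From mathcomp Require Import complex.
From mathcomp Require Import all_classical all_reals all_analysis.

Set Implicit Arguments.
Unset Strict Implicit.
Unset Printing Implicit Defensive.

Import Order.TTheory GRing.Theory Num.Theory.
Import numFieldNormedType.Exports.

Local Open Scope classical_set_scope.
Local Open Scope complex_scope.
Local Open Scope ring_scope.

(* [R[i]] carries its topology only through its regular module [R[i]^o]. *)
Notation cplx R := (R[i]^o).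

Definition cabs {R : rcfType} (z : R[i]) : R := Normc.normc z.

(* Measurable types are pointed in MathComp-Analysis; a topological group is
   pointed at 0 under this alias, which is used only to form its Borel sets. *)
Definition at_zero (G : topologicalZmodType) : Type := G.

HB.instance Definition _ (G : topologicalZmodType) :=
  Topological.copy (at_zero G) G.
HB.instance Definition _ (G : topologicalZmodType) :=
  isPointed.Build (at_zero G) (0 : G).

Definition borel (T : ptopologicalType) : Type :=
  g_sigma_algebraType (@open T).

HB.instance Definition _ (T : ptopologicalType) :=
  Measurable.copy (borel T) (g_sigma_algebraType (@open T)).

Definition sigma_compact (T : topologicalType) :=
  exists K : nat -> set T,
    (forall n, compact (K n)) /\ \bigcup_n K n = [set: T].

Section complex_integral.
Context d (T : measurableType d) (R : realType).
Variable mu : {measure set T -> \bar R}.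
Implicit Types (D : set T) (f : T -> cplx R).

Definition cmeasurable D f :=
  measurable_fun D (fun x => complex.Re (f x)) /\
  measurable_fun D (fun x => complex.Im (f x)).

Definition cintegrable D f :=
  mu.-integrable D (fun x => (complex.Re (f x))%:E) /\
  mu.-integrable D (fun x => (complex.Im (f x))%:E).

Definition cintegral D f : R[i] :=
  (\int[mu]_(x in D) complex.Re (f x)) +i*
  (\int[mu]_(x in D) complex.Im (f x)).

End complex_integral.

Section sq_atomic_measure.
Context d (T : measurableType d) (R : realType) (c : T -> R[i]).
Local Open Scope ereal_scope.

(* The measure \sum_x |c x|^2 \delta_x. *)
Definition sq_atomic (B : set T) : \bar R :=
  \esum_(x in [set: T]) ((cabs (c x) ^+ 2)%:E * \d_x B).

Let term_ge0 x (B : set T) : 0 <= (cabs (c x) ^+ 2)%:E * \d_x B :> \bar R.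
Proof. by rewrite mule_ge0// lee_fin sqr_ge0. Qed.

Let sq_atomic0 : sq_atomic set0 = 0.
Proof. by rewrite /sq_atomic esum1// => x _; rewrite dirac0 mule0. Qed.

Let sq_atomic_ge0 B : 0 <= sq_atomic B.
Proof. by apply: esum_ge0 => x _; exact: term_ge0. Qed.

Let sq_atomic_sigma_additive : semi_sigma_additive sq_atomic.
Proof.
move=> F mF tF mUF.
pose a x n := (cabs (c x) ^+ 2)%:E * \d_x (F n) : \bar R.
have a_ge0 x n : 0 <= a x n by exact: term_ge0.
suff -> : sq_atomic (\bigcup_n F n) = \sum_(n <oo) sq_atomic (F n).
  by apply: is_cvg_nneseries => n _ _; exact: sq_atomic_ge0.
rewrite nneseries_esumT//.
transitivity (\esum_(x in [set: T]) \esum_(n in [set: nat]) a x n).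
  apply: eq_esum => x _; rewrite -nneseries_esumT// /a nneseriesZl//.
    congr (_ * _); apply/esym/cvg_lim => //.
    exact: (@measure_semi_sigma_additive _ _ _ (dirac x)).
rewrite esum_esum// [RHS]esum_esum//.
rewrite (reindex_esum ([set: nat] `*`` (fun=> [set: T])) _
  (fun x => (x.2, x.1)))//.
split=> //.
- by move=> [i j] [k l] /= _ _ [] -> ->.
- by move=> [i j] _; exists (j, i).
Qed.

HB.instance Definition _ := isMeasure.Build _ _ _ sq_atomic
  sq_atomic0 sq_atomic_ge0 sq_atomic_sigma_additive.

End sq_atomic_measure.

Section dual_group.
Variables (R : realType) (G : topologicalZmodType).

Definition is_character : set {compact-open, G -> cplx R} :=
  [set chi | [/\ continuous (chi : G -> cplx R),
    forall s t : G, chi (s + t) = chi s * chi t &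
    forall t : G, cabs (chi t) = 1]].

(* The topology on the dual group is induced by the compact-open one. *)
Definition dual : Type := set_type is_character.

HB.instance Definition _ := Topological.copy dual (set_type is_character).

Lemma trivial_character_subproof : (fun=> 1) \in is_character.
Proof.
rewrite inE; split=> [||t]; first exact: cst_continuous.
- by move=> s t; rewrite mulr1.
- by rewrite /cabs Normc.normc1.
Qed.

Definition trivial_character : dual :=
  exist (fun chi => chi \in is_character) _ trivial_character_subproof.

HB.instance Definition _ := isPointed.Build dual trivial_character.

Definition dual_fun (chi : dual) : G -> cplx R := set_val chi.

End dual_group.

Coercion dual_fun : dual >-> Funclass.

Section harmonic_analysis.
Variables (R : realType) (G : topologicalZmodType).
Variable theta : {measure set (borel (at_zero G)) -> \bar R}.

Definition is_haar_measure :=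
  [/\ forall (B : set (borel (at_zero G))) (x : G), measurable B ->
        theta [set x + b | b in B] = theta B,
      forall K : set G, compact K -> (theta K < +oo)%E,
      forall U : set G, open U -> U !=set0 -> (0 < theta U)%E,
      forall B : set (borel (at_zero G)), measurable B ->
        theta B = ereal_inf [set theta U | U in [set U : set G |
                                 open U /\ B `<=` U]] &
      forall U : set G, open U ->
        theta U = ereal_sup [set theta K | K in [set K : set G |
                                 compact K /\ K `<=` U]]].

Definition vol (B : set G) : R := fine (theta B).

Definition boundary (K B : set G) : set G :=
  (closure [set a + k | a in B & k in K] `&` closure (~` B)) `|`
  (closure [set a - k | a in ~` B & k in K] `&` closure B).

Definition van_hove (A : nat -> set G) :=
  (forall n, [/\ open (A n), precompact (A n) & (0 < theta (A n))%E]) /\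
  (forall K : set G, compact K ->
     vol (boundary K (A n)) / vol (A n) @[n --> \oo] --> (0 : R)).

Definition L2loc : set (G -> cplx R) :=
  [set f | cmeasurable [set: borel (at_zero G)] f /\
    forall K : set G, compact K ->
      (\int[theta]_(t in K) (cabs (f t) ^+ 2)%:E < +oo)%E].

Definition Cc : set (G -> cplx R) :=
  [set phi | continuous phi /\ compact (closure [set t | phi t != 0])].

Definition convolution (f g : G -> cplx R) : G -> cplx R :=
  fun t => cintegral theta setT (fun s => f s * g (t - s)).

Definition tilde (f : G -> cplx R) : G -> cplx R := fun s => conjc (f (- s)).

Definition inverse_fourier (phi : G -> cplx R) (chi : dual R G) : R[i] :=
  cintegral theta setT (fun t => chi t * phi t).

(* Complex Radon measures on G are handled as functionals on [Cc]; this is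
   the measure h theta. *)
Definition density_measure (h : G -> cplx R) : (G -> cplx R) -> cplx R :=
  fun phi => cintegral theta setT (fun t => phi t * h t).

Definition positive_definite (gamma : (G -> cplx R) -> cplx R) :=
  forall phi, Cc phi ->
    (0 : R[i]) <= (gamma (convolution phi (tilde phi)) : R[i]).

(* The Fourier transform is unique, so it is given by its graph. *)
Definition is_fourier_transform (gamma : (G -> cplx R) -> cplx R)
    (nu : {measure set (borel (dual R G)) -> \bar R}) :=
  positive_definite gamma /\
  forall phi, Cc phi ->
    nu.-integrable setT (fun chi => (cabs (inverse_fourier phi chi) ^+ 2)%:E) /\
    (\int[nu]_chi (cabs (inverse_fourier phi chi) ^+ 2))%:C =
      gamma (convolution phi (tilde phi)).

Section averages.
Variable A : nat -> set G.

Definition average (f : G -> cplx R) (n : nat) : cplx R :=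
  ((vol (A n))^-1)%:C * cintegral theta (A n) f.

Definition is_reflected_eberlein (f h : G -> cplx R) :=
  forall t : G,
    (forall n, cintegrable theta (A n) (fun s => f s * conjc (f (s - t)))) /\
    average (fun s => f s * conjc (f (s - t))) @ \oo --> h t.

Definition besicovitch_norm (f : G -> cplx R) : \bar R :=
  limn_esup (fun n => ((((vol (A n))^-1)%:E *
    \int[theta]_(t in A n) (cabs (f t) ^+ 2)%:E) `^ (2^-1))%E).

Definition trigonometric_polynomial : set (G -> cplx R) :=
  [set P | exists (n : nat) (a : 'I_n -> R[i]) (chi : 'I_n -> dual R G),
    P = fun t => \sum_(i < n) a i * chi i t].

Definition besicovitch_ap : set (G -> cplx R) :=
  [set f | L2loc f /\ forall e : R, 0 < e ->
    exists2 P, trigonometric_polynomial P &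
      (besicovitch_norm (f - P)%R < e%:E)%E].

Definition is_fourier_bohr_coef (f : G -> cplx R) (chi : dual R G) (a : R[i]) :=
  average (fun t => conjc (chi t) * f t) @ \oo --> (a : cplx R).

Definition besicovitch_class (f : G -> cplx R) : set (G -> cplx R) :=
  [set g | L2loc g /\ besicovitch_norm (f - g)%R = 0%E].

End averages.

End harmonic_analysis.

Definition linear_subspace (K : pzRingType) (V : lmodType K) (C : set V) :=
  C 0 /\ forall (a : K) (f g : V), C f -> C g -> C (a *: f + g).

Definition seminorm_on (R : realType) (V : lmodType R[i]) (C : set V)
    (N : V -> R) :=
  [/\ forall f, C f -> 0 <= N f,
      forall (a : R[i]) f, C f -> N (a *: f) = cabs a * N f &
      forall f g, C f -> C g -> N (f + g) <= N f + N g].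

(* Main.v *)
Require Import Defs.
From HB Require Import structures.
From mathcomp Require Import all_boot all_order all_algebra.
From mathcomp Require Import complex.
From mathcomp Require Import all_classical all_reals all_analysis.
From mathcomp Require Import measurable_realfun ring lra.

Set Implicit Arguments.
Unset Strict Implicit.
Unset Printing Implicit Defensive.

Import Order.TTheory GRing.Theory Num.Theory.
Import numFieldNormedType.Exports.

Local Open Scope classical_set_scope.
Local Open Scope complex_scope.
Local Open Scope ring_scope.

(** Everything rests on [h_f 0 = ||f||^2], i.e. [mean |f|^2 = sum_chi |c_chi f|^2].
    Testing the Fourier transform of [h_f theta] on [phi * tilde phi], with [phi] a
    bump concentrating at 0, gives
      [int (phi * tilde phi) h_f = sum_chi |c_chi f|^2 |int chi phi|^2];
    the right-hand side divided by [(int phi)^2] tends to [||f||^2], the left-hand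
    side to [h_f 0] by continuity, once [int (phi * tilde phi) = (int phi)^2], which
    is the case [f = 1] of the same identity. The Besicovitch norm thus coincides
    with [||.||] on [C]; partial sums of the expansion are approximating
    trigonometric polynomials, and the Fourier-Bohr coefficients come from
    polarization against [f + chi] and [f + i chi]. Under the Riesz-Fischer
    condition, the coefficients of trigonometric polynomials approximating a
    Besicovitch function converge in l^2 to those of some [g] in [C]. *)

(** * Modulus, real part and imaginary part of complex numbers *)

Section complex_facts.
Variable R : realType.
Implicit Types z w : R[i].

Lemma cabs_sqr z : cabs z ^+ 2 = complex.Re z ^+ 2 + complex.Im z ^+ 2.
Proof. by case: z => a b; rewrite /cabs /= sqr_sqrtr ?addr_ge0 ?sqr_ge0. Qed.

Lemma normc_cabs z : `|z| = (cabs z)%:C.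
Proof. by rewrite normc_def; case: z. Qed.

Lemma cabs_ge0 z : 0 <= cabs z.
Proof. by case: z => a b; exact: sqrtr_ge0. Qed.

Lemma ler_Re_cabs z : `|complex.Re z| <= cabs z.
Proof. by rewrite -lecR -normc_cabs normc_ge_Re. Qed.

Lemma ler_Im_cabs z : `|complex.Im z| <= cabs z.
Proof.
by rewrite -(ler_sqr (normr_ge0 _) (cabs_ge0 _)) cabs_sqr real_normK ?num_real// lerDr sqr_ge0.
Qed.

Lemma cabs_le_ReIm z : cabs z <= `|complex.Re z| + `|complex.Im z|.
Proof.
rewrite -(ler_sqr (cabs_ge0 _)) ?nnegrE ?addr_ge0//.
rewrite cabs_sqr sqrrD !real_normK ?num_real// lerD2r lerDl.
by rewrite mulrn_wge0// mulr_ge0.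
Qed.

Lemma continuous_Re : continuous (@complex.Re R : cplx R -> R).
Proof.
move=> z; apply/(@cvgrPdist_lt _ R _ _ (nbhs_filter (z : cplx R))) => e e0.
have e0C : 0 < e%:C by rewrite ltcR.
have : \forall w \near z, `|z - w| < e%:C.
  by apply/(@nbhs_normP _ (cplx R)); exists (e%:C).
apply: filterS => w /=; rewrite [`|_|]normc_cabs ltcR.
by apply: le_lt_trans; rewrite -raddfB ler_Re_cabs.
Qed.

Lemma continuous_Im : continuous (@complex.Im R : cplx R -> R).
Proof.
move=> z; apply/(@cvgrPdist_lt _ R _ _ (nbhs_filter (z : cplx R))) => e e0.
have e0C : 0 < e%:C by rewrite ltcR.
have : \forall w \near z, `|z - w| < e%:C.
  by apply/(@nbhs_normP _ (cplx R)); exists (e%:C).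
apply: filterS => w /=; rewrite [`|_|]normc_cabs ltcR.
by apply: le_lt_trans; rewrite -raddfB ler_Im_cabs.
Qed.

Lemma cvg_complex {T} (F : set_system T) {FF : Filter F} (u : T -> cplx R) (z : cplx R) :
  (fun t => complex.Re (u t)) @ F --> complex.Re z ->
  (fun t => complex.Im (u t)) @ F --> complex.Im z -> u @ F --> z.
Proof.
move=> /(@cvgrPdist_lt _ R) cRe /(@cvgrPdist_lt _ R) cIm.
apply/(@cvgrPdist_lt _ (cplx R)) => -[e e'] /=.
(* The radius ranges over [R[i]]; positivity there forces its imaginary part to vanish, so it is the
   real number [e]. *)
rewrite ltcE/= => /andP[/eqP -> e0].
have e20 : 0 < e / 2 by rewrite divr_gt0.
near=> t; rewrite [`|_|]normc_cabs ltcR.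
apply: (le_lt_trans (cabs_le_ReIm _)); rewrite [ltRHS](splitr e) ltrD// raddfB/=.
- by near: t; exact: cRe.
- by near: t; exact: cIm.
Unshelve. all: by end_near. Qed.

Lemma continuous_real_complex : continuous (fun r : R => r%:C : cplx R).
Proof. by move=> r; apply: cvg_complex => //=; exact: cvg_cst. Qed.

End complex_facts.

(** * Topological groups: Borel sets and bump functions *)

Lemma continuous_sub (G : topologicalZmodType) (T : topologicalType) (f g : T -> G) :
  continuous f -> continuous g -> continuous (fun x => f x - g x).
Proof.
move=> cf cg x; apply: (@continuous_comp _ _ _ (fun y => (f y, g y)) (fun y => y.1 - y.2)).
  by apply: cvg_pair; [exact: cf|exact: cg].
exact: sub_continuous.
Qed.

Section borel_topology.
Variables (R : realType) (G : topologicalZmodType).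

Lemma borel_open (U : set G) : open U -> measurable (U : set (borel (at_zero G))).
Proof. by move=> oU; exact: sub_sigma_algebra. Qed.

Lemma borel_closed (F : set G) : closed F -> measurable (F : set (borel (at_zero G))).
Proof. by move/closed_openC/borel_open/measurableC; rewrite setCK. Qed.

Lemma continuous_borel (f : G -> R) : continuous f ->
  measurable_fun [set: borel (at_zero G)] f.
Proof.
move=> /continuousP cf; apply: (measurability _ (measurable_realfun.RGenOpens.measurableE R)).
move=> _ [_ [a [b ->] <-]]; rewrite setTI; apply: borel_open.
exact/cf/interval_open.
Qed.

Hypothesis hausG : hausdorff_space G.
Hypothesis lcG : locally_compact [set: G].

(** Complete regularity of locally compact Hausdorff spaces separates 0 from the complement of an
    open [V] contained in both [U] and a compact [K]; one minus the separating function is the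
    bump. *)
Lemma bump_function (U : set G) : nbhs (0 : G) U ->
  exists (phi : G -> R) (K : set G), [/\ continuous phi,
    forall t, 0 <= phi t <= 1, phi 0 = 1, compact K &
    forall t, phi t != 0 -> U t /\ K t].
Proof.
move=> U0; have [K] := lcG (I : [set: G] 0); rewrite withinET => K0 [cK _].
have : nbhs (0 : G) (U `&` K) by exact: filterI.
rewrite nbhsE => -[V [oV V0] VUK].
have := @locally_compact_completely_regular G R lcG hausG 0 (~` V).
move=> /(_ (open_closedC oV)) /(_ (fun h => h V0)).
move=> /(@uniform_separatorP _ R)[f [cf f01 f0 f1]].
exists (fun t => 1 - f t), K; split => //.
- by move=> t; apply: cvgB; [exact: cvg_cst|exact: cf].
- move=> t; have := f01 (f t) (ex_intro2 _ _ t I erefl).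
  by rewrite /= in_itv/= => /andP[? ?]; rewrite subr_ge0 lerBlDr lerDl; apply/andP.
- by rewrite (f0 (f 0)) ?subr0//; exists 0.
- move=> t ft; apply: VUK; apply: contrapT => Vt.
  by move: ft; rewrite (f1 (f t)) ?subrr ?eqxx//; exists t.
Qed.
End borel_topology.

(** * Domination, and the modulus of a complex integral *)

Section integral_facts.
Context d (T : measurableType d) (R : realType).
Variable mu : {measure set T -> \bar R}.

Lemma integrable_support (K : set T) (f : T -> R) (M : R) :
  measurable K -> (mu K < +oo)%E -> measurable_fun setT f ->
  (forall x, `|f x| <= M) -> (forall x, f x != 0 -> K x) ->
  mu.-integrable setT (fun x => (f x)%:E).
Proof.
move=> mK Koo mf fM fK.
have -> : (fun x => (f x)%:E) = (EFin \o f) \_ K.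
  apply/funext => x; rewrite patchE; case: ifPn => //; rewrite notin_setE => Kx.
  by have [->//|/fK] := eqVneq (f x) 0.
apply: (iffLR (integrable_mkcond _ _)) => //; apply: measurable_bounded_integrable => //.
  exact: measurable_funTS.
exists M; split; first exact: num_real.
by move=> y My x _; exact: le_trans (fM x) (ltW My).
Qed.

Lemma integrable_dominated (f g : T -> R) : measurable_fun setT f ->
  (forall x, `|f x| <= g x) -> mu.-integrable setT (fun x => (g x)%:E) ->
  mu.-integrable setT (fun x => (f x)%:E).
Proof.
move=> mf fg; apply: le_integrable => //; first exact/measurable_EFinP.
by move=> x _; rewrite !abse_EFin lee_fin (le_trans (fg x))// ler_norm.
Qed.

(** With [z] the integral, supposed nonzero, both sides are multiplied by [|z|]: then [|z|^2] is the
    integral of [Re z Re u + Im z Im u], which is pointwise at most [|z| |u|]. *)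
Lemma cabs_cintegral_le (u : T -> cplx R) (g : T -> R) :
  cmeasurable setT u -> (forall x, cabs (u x) <= g x) ->
  mu.-integrable setT (fun x => (g x)%:E) ->
  cabs (cintegral mu setT u) <= \int[mu]_x g x.
Proof.
move=> [mre mim] ug ig.
have ire : mu.-integrable setT (fun x => (complex.Re (u x))%:E).
  apply: (integrable_dominated mre _ ig) => x.
  exact: le_trans (ler_Re_cabs _) (ug x).
have iim : mu.-integrable setT (fun x => (complex.Im (u x))%:E).
  apply: (integrable_dominated mim _ ig) => x.
  exact: le_trans (ler_Im_cabs _) (ug x).
set z := cintegral _ _ _.
have [->|z0] := eqVneq (cabs z) 0.
  by apply: Rintegral_ge0 => x _; exact: le_trans (cabs_ge0 _) (ug x).
have zgt0 : 0 < cabs z by rewrite lt_def z0 cabs_ge0.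
rewrite -(ler_pM2l zgt0) -expr2 cabs_sqr.
rewrite -RintegralZl// !expr2 -{1}[in leLHS]RintegralZl//.
rewrite -[in X in _ + X]RintegralZl// -RintegralD//; last 2 first.
- exact: (integrableZl _ (complex.Re z) ire).
- exact: (integrableZl _ (complex.Im z) iim).
apply: le_Rintegral => //.
- apply: (@integrableD _ _ _ mu setT _ (fun x => (complex.Re z * complex.Re (u x))%:E)
    (fun x => (complex.Im z * complex.Im (u x))%:E)) => //.
  + exact: (integrableZl _ (complex.Re z) ire).
  + exact: (integrableZl _ (complex.Im z) iim).
- exact: (integrableZl _ (cabs z) ig).
move=> x _; apply: (@le_trans _ _ (cabs z * cabs (u x))); last first.
  by rewrite ler_pM2l.
(* Cauchy-Schwarz in the plane *)
apply: (le_trans (ler_norm _)).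
rewrite -ler_sqr ?nnegrE ?mulr_ge0 ?cabs_ge0// real_normK ?num_real//.
rewrite exprMn !cabs_sqr.
set a := complex.Re z; set b := complex.Im z.
set p := complex.Re (u x); set q := complex.Im (u x).
rewrite -subr_ge0.
have -> : (a ^+ 2 + b ^+ 2) * (p ^+ 2 + q ^+ 2) - (a * p + b * q) ^+ 2
  = (a * q - b * p) ^+ 2 by ring.
exact: sqr_ge0.
Qed.

End integral_facts.

(** * Integrals against a weighted sum of Dirac masses *)

Section atomic_integral.
Context d (T : measurableType d) (R : realType) (b : T -> R[i]) (S : R).
Hypothesis bS : (\esum_(x in [set: T]) (cabs (b x) ^+ 2)%:E = S%:E)%E.
Variables (w : T -> R).
Hypothesis iw : (sq_atomic b).-integrable setT (fun x => (w x)%:E).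

Lemma sq_atomicT : sq_atomic b setT = S%:E.
Proof.
by rewrite -bS; apply: eq_esum => x _; rewrite diracT mule1.
Qed.

Lemma Rintegral_sq_atomic_le (M : R) : (forall x, w x <= M) ->
  \int[sq_atomic b]_x w x <= M * S.
Proof.
move=> wM.
have -> : M * S = \int[sq_atomic b]_x M.
  by rewrite (Rintegral_cst _ measurableT) [X in fine X]sq_atomicT.
apply: le_Rintegral => //.
apply: (integrable_support (K := setT) (M := `|M|)) => //.
by rewrite [X in (X < _)%E]sq_atomicT ltry.
Qed.

(** Finite sets may fail to be measurable in [T], so the bound passes through the superlevel set [B]
    of [w]: it is measurable, contains [F], and has mass at least the sum over [F]. *)
Lemma Rintegral_sq_atomic_ge (F : set T) (q : R) : finite_set F ->
  0 <= q -> (forall x, 0 <= w x) -> (forall x, F x -> q <= w x) ->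
  q * (\sum_(x \in F) cabs (b x) ^+ 2) <= \int[sq_atomic b]_x w x.
Proof.
move=> finF q0 w0 Fq.
have mw : measurable_fun setT w by apply/measurable_EFinP; exact: (measurable_int _ iw).
pose B := [set x | q <= w x].
have mB : measurable B.
  have -> : B = setT `&` w @^-1` `[q, +oo[.
    by apply/seteqP; split => x; rewrite /B /= in_itv/= andbT// => -[].
  exact: mw.
rewrite -lee_fin /Rintegral fineK ?integrable_fin_num//.
apply: (@le_trans _ _ (\int[sq_atomic b]_(x in B) q%:E)%E).
  rewrite integral_cst// EFinM; apply: lee_wpmul2l; first by rewrite lee_fin.
  apply: (@le_trans _ _ (\sum_(x \in F) ((cabs (b x) ^+ 2)%:E * \d_x B))%E).
    rewrite -fsumEFin//; apply: lee_fsum => // x Fx.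
    by rewrite diracE mem_set ?mule1//; exact: Fq.
  by apply: ereal_sup_ubound; exists F.
apply: (@le_trans _ _ (\int[sq_atomic b]_(x in B) (w x)%:E)%E).
  by apply: ge0_le_integral => //; apply/measurable_EFinP; exact: measurable_funTS.
apply: ge0_subset_integral => //; first exact/measurable_EFinP.
by move=> x _; rewrite lee_fin.
Qed.

End atomic_integral.

(** * The autocorrelation of a bump function *)

Section bump_convolution.
Variables (R : realType) (G : topologicalZmodType).
Hypothesis hausG : hausdorff_space G.
Variable theta : {measure set (borel (at_zero G)) -> \bar R}.
Hypothesis haar : is_haar_measure theta.

Lemma haar_compact (K : set G) : compact K ->
  measurable (K : set (borel (at_zero G))) /\ (theta K < +oo)%E.
Proof.
case: haar => _ Koo _ _ _ cK; split; last exact: Koo.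
by apply: borel_closed; exact: compact_closed.
Qed.

Variables (phi : G -> R) (K : set G).
Hypothesis cphi : continuous phi.
Hypothesis phi01 : forall t, 0 <= phi t <= 1.
Hypothesis phi0 : phi 0 = 1.
Hypothesis cK : compact K.
Hypothesis phiK : forall t, phi t != 0 -> K t.

Local Notation mass := (\int[theta]_t phi t).

(** This is [phi * tilde phi] for real [phi], because [tilde phi] at [t - s] is [phi (s - t)]. A
    real-valued form keeps the estimates below in [R]. *)
Definition autocorrelation (t : G) : R :=
  \int[theta]_s (phi s * phi (s - t)).

Let mphi : measurable_fun [set: borel (at_zero G)] phi.
Proof. exact: continuous_borel. Qed.

Lemma bump_ge0 t : 0 <= phi t. Proof. by case/andP: (phi01 t). Qed.

Lemma bump_integrable : theta.-integrable setT (fun t => (phi t)%:E).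
Proof.
have [mK Koo] := haar_compact cK.
apply: (integrable_support mK Koo mphi (M := 1)) => // t.
by rewrite ger0_norm ?bump_ge0//; case/andP: (phi01 t).
Qed.

(** The open set [U] where [phi > 1/2] contains 0, hence has positive Haar measure. *)
Lemma bump_mass_gt0 : 0 < mass.
Proof.
pose U : set G := phi @^-1` `]2^-1, +oo[.
have oU : open U by move/continuousP : cphi; apply; exact: interval_open.
have [_ _ /(_ U oU) thetaU _ _] := haar.
have U0 : U 0 by rewrite /U /= in_itv/= phi0 andbT invf_lt1 ?ltr1n.
have {}thetaU := thetaU (ex_intro _ 0 U0).
have mU : measurable (U : set (borel (at_zero G))) by exact: borel_open.
rewrite -lte_fin /Rintegral fineK; last exact: (integrable_fin_num measurableT bump_integrable).
apply: (@lt_le_trans _ _ (\int[theta]_(x in (U : set (borel (at_zero G)))) (2^-1)%:E)%E).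
  by rewrite integral_cst// mule_gt0// lte_fin invr_gt0.
apply: (@le_trans _ _ (\int[theta]_(x in (U : set (borel (at_zero G)))) (phi x)%:E)%E).
  apply: ge0_le_integral => //.
  - by apply/measurable_EFinP; exact: measurable_funTS.
  - by move=> x; rewrite /U /= in_itv/= andbT lee_fin => /ltW.
apply: ge0_subset_integral => //; first exact/measurable_EFinP.
by move=> x _; rewrite lee_fin bump_ge0.
Qed.

Lemma continuous_translate (t : G) : continuous (fun s : G => phi (s - t)).
Proof.
move=> s; apply: (@continuous_comp _ _ _ (fun s : G => s - t) phi); last exact: cphi.
apply: (@continuous_sub _ _ (fun s : G => s) (fun=> t)); first by move=> x; exact: cvg_id.
by move=> x; exact: cvg_cst.
Qed.

Lemma autocorrelation_integrable (t : G) :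
  theta.-integrable setT (fun s => (phi s * phi (s - t))%:E).
Proof.
apply: (integrable_dominated _ _ bump_integrable) => [|s].
  apply: (@continuous_borel _ _ (fun s => phi s * phi (s - t))) => s.
  by apply: cvgM; [exact: cphi|exact: continuous_translate].
rewrite ger0_norm ?mulr_ge0 ?bump_ge0//.
by rewrite ler_piMr ?bump_ge0//; case/andP: (phi01 (s - t)).
Qed.

Lemma autocorrelation_ge0 t : 0 <= autocorrelation t.
Proof. by apply: Rintegral_ge0 => s _; rewrite mulr_ge0 ?bump_ge0. Qed.

(** Otherwise the integrand vanishes identically. This confines the autocorrelation to a small
    neighbourhood of 0 when [phi] is supported in one. *)
Lemma autocorrelation_support t : autocorrelation t != 0 ->
  exists r s, [/\ phi r != 0, phi s != 0 & t = r - s].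
Proof.
move=> gt; apply: contrapT => nrs; move/eqP: gt; apply.
rewrite /autocorrelation; under eq_Rintegral.
  move=> s _; rewrite (_ : _ * _ = 0); last first.
    apply/eqP; rewrite mulf_eq0; apply/negPn; rewrite negb_or; apply/negP => /andP[p q].
    by apply: nrs; exists s, (s - t); rewrite opprB addrCA subrr addr0.
  over.
by rewrite (Rintegral_cst _ measurableT) mul0r.
Qed.

(** By compactness of [K], [phi (s - t')] is close to [phi (s - t)] uniformly in [s] in [K] once
    [t'] is near [t]. The tolerance [e / mass], integrated against [phi], gives [e]. *)
Lemma continuous_autocorrelation : continuous autocorrelation.
Proof.
move=> t; apply/(@cvgrPdist_le _ R) => e e0.
have m0 := bump_mass_gt0.
have em0 : 0 < e / mass by rewrite divr_gt0.
have /compact_near_coveringP cov := cK.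
have : \forall t' \near t, K `<=` [set s | `|phi (s - t') - phi (s - t)| < e / mass].
  apply: cov => s Ks.
  change (\forall p \near (s, t), `|phi (p.1 - p.2) - phi (p.1 - t)| < e / mass).
  have cphiq (q : G * G -> G) : continuous q ->
      (fun p => phi (q p)) @ (s, t) --> phi (q (s, t)).
    by move=> cq; exact: (continuous_comp (cq (s, t)) (@cphi (q (s, t)))).
  have : (fun p : G * G => phi (p.1 - p.2) - phi (p.1 - t)) @ (s, t) -->
      phi (s - t) - phi (s - t).
    apply: cvgB.
      exact: (cphiq (fun p => p.1 - p.2) (@sub_continuous G)).
    apply: (cphiq (fun p => p.1 - t)).
    apply: (@continuous_sub _ _ (fun p : G * G => p.1) (fun=> t)).
      by move=> ?; exact: cvg_fst.
    by move=> ?; exact: cvg_cst.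
  move/(@cvgrPdist_lt _ R)/(_ _ em0).
  by apply: filterS => p; rewrite subrr sub0r normrN.
apply: filterS => t' Kt'.
rewrite /autocorrelation -RintegralB//; try exact: autocorrelation_integrable.
have -> : e = \int[theta]_s (e / mass * phi s).
  by rewrite RintegralZl ?bump_integrable// divfK ?gt_eqF.
have ie := integrableZl measurableT (e / mass) bump_integrable.
have ib : theta.-integrable setT (fun s => (phi s * phi (s - t) - phi s * phi (s - t'))%:E).
  apply: (@integrableB _ _ _ theta setT _ (fun s => (phi s * phi (s - t))%:E)
    (fun s => (phi s * phi (s - t'))%:E)) => //; exact: autocorrelation_integrable.
apply: le_trans (le_normr_Rintegral _ _) _ => //.
apply: le_Rintegral => //; first exact: (integrable_norm ib).
move=> s _; rewrite -mulrBr normrM ger0_norm ?bump_ge0// mulrC.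
have [->|p0] := eqVneq (phi s) 0; first by rewrite !mulr0.
rewrite ler_wpM2r ?bump_ge0// distrC; apply: ltW; apply: Kt'; exact: phiK.
Qed.

End bump_convolution.

(** * Elementary properties of characters *)

Section characters.
Variables (R : realType) (G : topologicalZmodType).
Implicit Type chi : dual R G.

Lemma dual_funP chi : [/\ continuous (chi : G -> cplx R),
  forall s t : G, chi (s + t) = chi s * chi t & forall t : G, cabs (chi t) = 1].
Proof. exact: (set_mem (valP chi)). Qed.

Lemma dual_fun0 chi : chi 0 = 1.
Proof.
have [_ chiD chi1] := dual_funP chi.
have c0 : chi 0 != 0.
  apply/eqP => c0; have := chi1 0.
  by rewrite c0 /cabs Normc.normc0 => /esym/eqP; rewrite oner_eq0.
by apply: (mulfI c0); rewrite -chiD addr0 mulr1.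
Qed.

Lemma continuous_Re_comp (h : G -> cplx R) : continuous h ->
  continuous (fun t => complex.Re (h t)).
Proof. by move=> ch t; exact: (continuous_comp (ch t) (@continuous_Re R (h t))). Qed.

Lemma continuous_Im_comp (h : G -> cplx R) : continuous h ->
  continuous (fun t => complex.Im (h t)).
Proof. by move=> ch t; exact: (continuous_comp (ch t) (@continuous_Im R (h t))). Qed.

End characters.

(** * The inverse Fourier transform of a bump function *)

Section fourier_bump.
Variables (R : realType) (G : topologicalZmodType).
Hypothesis hausG : hausdorff_space G.
Variable theta : {measure set (borel (at_zero G)) -> \bar R}.
Hypothesis haar : is_haar_measure theta.
Variables (phi : G -> R) (K : set G).
Hypothesis cphi : continuous phi.
Hypothesis phi01 : forall t, 0 <= phi t <= 1.
Hypothesis phi0 : phi 0 = 1.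
Hypothesis cK : compact K.
Hypothesis phiK : forall t, phi t != 0 -> K t.

Local Notation mass := (\int[theta]_t phi t).
Local Notation Phi := (fun t : G => (phi t)%:C : cplx R).
Local Notation psi := (autocorrelation theta phi).

Let iphi : theta.-integrable setT (fun t => (phi t)%:E).
Proof. exact: (bump_integrable hausG haar cphi phi01 cK phiK). Qed.

Lemma bump_Cc : Cc Phi.
Proof.
split.
  by move=> t; exact: (continuous_comp (@cphi t) (@continuous_real_complex R (phi t))).
have clK : closed K by exact: compact_closed.
apply: (subclosed_compact _ cK); first exact: closed_closure.
rewrite [X in _ `<=` X](closure_id K).1//; apply: closureS => t /= pt; apply: phiK.
by apply: contraNneq pt => ->.
Qed.

Lemma convolution_bump : convolution theta Phi (tilde Phi) = (fun t => (psi t)%:C).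
Proof.
apply/funext => t; rewrite /convolution /cintegral /autocorrelation /tilde.
congr (_ +i* _).
  apply: eq_Rintegral => s _ /=.
  by rewrite opprB oppr0 !mulr0 subr0.
under eq_Rintegral => s _ do rewrite /= oppr0 mulr0 mul0r addr0.
by rewrite (Rintegral_cst _ measurableT) mul0r.
Qed.

Lemma Re_density_bump (h : G -> cplx R) :
  complex.Re (density_measure theta h (fun t => (psi t)%:C)) =
  \int[theta]_t (psi t * complex.Re (h t)).
Proof.
rewrite /density_measure /cintegral /=; apply: eq_Rintegral => t _.
by case: (h t) => x y /=; rewrite mul0r subr0.
Qed.

Let cmeasurable_char (chi : dual R G) :
  cmeasurable [set: borel (at_zero G)] (fun t => chi t * Phi t).
Proof.
have [cchi _ _] := dual_funP chi.
have cRe := continuous_Re_comp cchi; have cIm := continuous_Im_comp cchi.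
split.
  apply: (@continuous_borel _ _ (fun t => complex.Re (chi t * Phi t))) => t.
  rewrite (_ : (fun t => _) = (fun t => complex.Re (chi t) * phi t)); last first.
    by apply/funext => s; case: (chi s) => x y /=; rewrite mulr0 subr0.
  by apply: cvgM; [exact: cRe|exact: cphi].
apply: (@continuous_borel _ _ (fun t => complex.Im (chi t * Phi t))) => t.
rewrite (_ : (fun t => _) = (fun t => complex.Im (chi t) * phi t)); last first.
  by apply/funext => s; case: (chi s) => x y /=; rewrite mulr0 add0r.
by apply: cvgM; [exact: cIm|exact: cphi].
Qed.

Let cabs_char (chi : dual R G) t : cabs (chi t * Phi t) <= phi t.
Proof.
have [_ _ chi1] := dual_funP chi.
rewrite /cabs Normc.normcM [X in X * _]chi1 mul1r /=.
rewrite expr0n addr0 sqrtr_sqr ger0_norm//.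
exact: bump_ge0.
Qed.

Lemma inverse_fourier_bump_le (chi : dual R G) :
  cabs (inverse_fourier theta Phi chi) ^+ 2 <= mass ^+ 2.
Proof.
rewrite ler_sqr ?nnegrE ?cabs_ge0 ?Rintegral_ge0//; last first.
  by move=> t _; exact: bump_ge0.
by apply: cabs_cintegral_le => // t; exact: cabs_char.
Qed.

(** The real part of the integral of [chi * phi] already exceeds [r * mass]. Against the upper bound
    [mass ^+ 2], this squeezes the squared transform when [r] is close to 1. *)
Lemma inverse_fourier_bump_ge (chi : dual R G) (r : R) : 0 <= r ->
  (forall t, phi t != 0 -> r <= complex.Re (chi t)) ->
  (r * mass) ^+ 2 <= cabs (inverse_fourier theta Phi chi) ^+ 2.
Proof.
move=> r0 rchi.
have m0 : 0 <= mass by apply: Rintegral_ge0 => t _; exact: bump_ge0.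
rewrite ler_sqr ?nnegrE ?cabs_ge0 ?mulr_ge0//.
apply: le_trans (ler_Re_cabs _); apply: le_trans (ler_norm _).
rewrite -RintegralZl//= ; apply: le_Rintegral => //.
- exact: (integrableZl _ r iphi).
- apply: (integrable_dominated _ _ iphi) => [|t].
    by have [] := cmeasurable_char chi.
  exact: le_trans (ler_Re_cabs _) (cabs_char _ _).
move=> t _.
have -> : complex.Re (chi t * Phi t) = complex.Re (chi t) * phi t.
  by case: (chi t) => x y /=; rewrite mulr0 subr0.
have [->|pt] := eqVneq (phi t) 0; first by rewrite !mulr0.
by rewrite ler_wpM2r ?rchi//; exact: bump_ge0.
Qed.

(** * Two-sided bounds for [phi * tilde phi] tested against [h] *)

Section sandwich.
Variables (h : G -> cplx R) (b : dual R G -> R[i]) (S : R).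
Hypothesis bS : (\esum_(chi in setT) (cabs (b chi) ^+ 2)%:E = S%:E)%E.
Hypothesis hb : is_fourier_transform theta (density_measure theta h)
  (sq_atomic (b : borel (dual R G) -> R[i])).

(** The Fourier transform turns the left-hand side into the integral of the squared transform of
    [phi] against an atomic measure of total mass [S]. *)
Lemma autocorrelation_le : \int[theta]_t (psi t * complex.Re (h t)) <= mass ^+ 2 * S.
Proof.
have [_ /(_ _ bump_Cc)[iw eqw]] := hb.
rewrite -Re_density_bump -convolution_bump -eqw.
exact: (@Rintegral_sq_atomic_le _ (borel (dual R G)) R b S bS _ iw _ inverse_fourier_bump_le).
Qed.

(** Atoms outside [F] contribute nonnegative amounts, so the lower bound only has to control
    finitely many characters, which a small support of [phi] achieves. *)
Lemma autocorrelation_ge (F : set (dual R G)) (r : R) : finite_set F -> 0 <= r ->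
  (forall chi, F chi -> forall t, phi t != 0 -> r <= complex.Re (chi t)) ->
  (r * mass) ^+ 2 * (\sum_(chi \in F) cabs (b chi) ^+ 2) <=
  \int[theta]_t (psi t * complex.Re (h t)).
Proof.
move=> finF r0 Fr.
have [_ /(_ _ bump_Cc)[iw eqw]] := hb.
rewrite -Re_density_bump -convolution_bump -eqw.
apply: (Rintegral_sq_atomic_ge iw finF (sqr_ge0 _)) => chi; first exact: sqr_ge0.
by move=> Fchi; exact: (inverse_fourier_bump_ge r0 (Fr _ Fchi)).
Qed.

End sandwich.

End fourier_bump.

(** * Unordered sums and their finite partial sums *)

Lemma esum_char_sq (R : realType) (T : choiceType) (x : T) :
  (\esum_(y in [set: T]) (cabs ((y == x)%:R : R[i]) ^+ 2)%:E = 1)%E.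
Proof.
transitivity (\esum_(y in [set x]) (1%:E : \bar R))%E; last by rewrite esum_set1.
rewrite [RHS]esum_mkcond; apply: eq_esum => y _; have [->|yx] := eqVneq y x.
  by rewrite mem_set// /cabs Normc.normc1 expr1n.
by rewrite memNset /cabs ?Normc.normc0 ?expr0n//; exact/eqP.
Qed.

Lemma esum_finite_approx (R : realType) (T : choiceType) (a : T -> R) (S e : R) :
  (\esum_(x in [set: T]) (a x)%:E = S%:E)%E -> 0 < e ->
  exists2 F : set T, finite_set F & S - e < \sum_(x \in F) a x.
Proof.
move=> aS e0; have : ((S - e)%:E < \esum_(x in [set: T]) (a x)%:E)%E.
  by rewrite aS lte_fin ltrBlDr ltrDl.
move=> /ereal_sup_gt[_ [F [finF _] <-]]; rewrite fsumEFin// lte_fin => SF.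
by exists F.
Qed.

Lemma esum_finite_le (R : realType) (T : choiceType) (a : T -> R) (S : R) (F : set T) :
  (\esum_(x in [set: T]) (a x)%:E <= S%:E)%E -> finite_set F ->
  \sum_(x \in F) a x <= S.
Proof.
move=> aS finF; rewrite -lee_fin -fsumEFin//; apply: le_trans aS.
by apply: ereal_sup_ubound; exists F.
Qed.

(** * The value at 0 of a function whose Fourier transform is atomic *)

Section eberlein_at_zero.
Variables (R : realType) (G : topologicalZmodType).
Hypothesis hausG : hausdorff_space G.
Hypothesis lcG : locally_compact [set: G].
Variable theta : {measure set (borel (at_zero G)) -> \bar R}.
Hypothesis haar : is_haar_measure theta.
Hypothesis fourier1 : is_fourier_transform theta (density_measure theta (fun=> 1))
  (sq_atomic (fun xi : borel (dual R G) => (xi == trivial_character R G :> dual R G)%:R : R[i])).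

Variables (h : G -> cplx R) (b : dual R G -> R[i]) (S : R).
Hypothesis ch : continuous h.
Hypothesis bS : (\esum_(chi in setT) (cabs (b chi) ^+ 2)%:E = S%:E)%E.
Hypothesis hb : is_fourier_transform theta (density_measure theta h)
  (sq_atomic (b : borel (dual R G) -> R[i])).

(* The Fourier transform of [theta] being the Dirac mass at the trivial character
   spares Fubini's theorem, which would need the product of Borel sigma-algebras. *)
Lemma Rintegral_autocorrelation (phi : G -> R) (K : set G) : continuous phi ->
  (forall t, 0 <= phi t <= 1) -> compact K ->
  (forall t, phi t != 0 -> K t) ->
  \int[theta]_t (autocorrelation theta phi t) = (\int[theta]_t phi t) ^+ 2.
Proof.
move=> cphi phi01 cK phiK.
have -> : \int[theta]_t (autocorrelation theta phi t) =
    \int[theta]_t (autocorrelation theta phi t * complex.Re (1 : R[i])).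
  by apply: eq_Rintegral => t _; rewrite mulr1.
have S1 := @esum_char_sq R _ (trivial_character R G).
apply/eqP; rewrite eq_le; apply/andP; split.
  rewrite -[leRHS]mulr1.
  exact: (autocorrelation_le hausG haar cphi phi01 cK phiK S1 fourier1).
(* The only atom is the trivial character, whose real part is 1 everywhere, so [r = 1] is allowed
   and the lower bound meets the upper one. *)
have := autocorrelation_ge hausG haar cphi phi01 cK phiK fourier1
  (finite_set1 (trivial_character R G)) (@ler01 R).
rewrite fsbig_set1 mul1r eqxx /cabs Normc.normc1 expr1n mulr1; apply.
by move=> chi -> t _.
Qed.

(** The hinge of the proof: for [h] the Eberlein convolution of [f] and [b] its coefficients, the
    limit of the means of [|f|^2] becomes the square sum of the coefficients. *)
Lemma eberlein_at_zero : complex.Re (h 0) = S.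
Proof.
set h0 := complex.Re (h 0).
have S0 : 0 <= S by rewrite -lee_fin -bS esum_ge0// => x _; rewrite lee_fin sqr_ge0.
suff key (e : R) : 0 < e -> e < 1 -> h0 - e <= S /\ S - e * (2 + 2 * S) <= h0.
  have S20 : 0 < 2 + 2 * S by rewrite ltr_wpDr ?mulr_ge0.
  have S21 : 1 <= 2 + 2 * S by lra.
  apply/eqP; rewrite eq_le; apply/andP; split; apply/ler_addgt0Pr => e e0.
    (* The estimate [key] is stated for [e < 1] only, hence the cap at 1/2 here and below. *)
    pose e' := Num.min e 2^-1.
    have [||+ _] := key e'.
    - by rewrite lt_min e0 invr_gt0 ltr0n.
    - by rewrite gt_min invf_lt1 ?ltr1n// orbT.
    by rewrite lerBlDr => /le_trans; apply; rewrite lerD2l ge_min lexx.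
  pose e' := Num.min (e / (2 + 2 * S)) 2^-1.
  have [||_ +] := key e'.
  - by rewrite lt_min divr_gt0// invr_gt0 ltr0n.
  - by rewrite gt_min invf_lt1 ?ltr1n// orbT.
  rewrite lerBlDr => /le_trans; apply; rewrite lerD2l -ler_pdivlMr//.
  by rewrite ge_min lexx.
move=> e0 e1.
have [F finF SF] := esum_finite_approx bS e0.
have cRe := continuous_Re_comp ch.
pose U := [set t : G | `|h0 - complex.Re (h t)| < e].
have U0 : nbhs (0 : G) U.
  have := cRe 0; move/(@cvgrPdist_lt _ R)/(_ _ e0); exact.
(* The autocorrelation lives on differences of points of the support of [phi]; placing that support
   in [W] puts those differences in [U]. *)
have [W W0 WU] : exists2 W, nbhs (0 : G) W & forall r s, W r -> W s -> U (r - s).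
  have := @sub_continuous G (0, 0); rewrite /continuous_at /= subrr => /(_ _ U0).
  move=> [[W1 W2] [/= W10 W20] WU]; exists (W1 `&` W2); first exact: filterI.
  by move=> r s [Wr _] [_ Ws]; exact: (WU (r, s)).
(* Each character is 1 at 0, so the finitely many characters in [F] have real part at least [1 - e]
   on a common neighbourhood. *)
pose V := \bigcap_(chi in F) [set t : G | 1 - e <= complex.Re (dual_fun chi t)].
have V0 : nbhs (0 : G) V.
  move: (finF) => /finite_fsetP[D FD]; rewrite /V FD.
  apply: filter_bigI => chi _ /=.
  have [cchi _ _] := dual_funP chi.
  have := @continuous_Re_comp R G _ cchi 0; rewrite /continuous_at dual_fun0.
  move/(@cvgrPdist_lt _ R)/(_ _ e0); apply: filterS => t /=.
  by move/(le_lt_trans (ler_norm _))/ltW; rewrite lerBlDr addrC -lerBlDr.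
have [phi [K [cphi phi01 phi0 cK phiWK]]] :=
  @bump_function R G hausG lcG (W `&` V) (filterI W0 V0).
have phiK t : phi t != 0 -> K t by move=> /phiWK[].
set psi := autocorrelation theta phi.
pose m := \int[theta]_t phi t.
have m0 : 0 < m by exact: (bump_mass_gt0 hausG haar cphi phi01 phi0 cK phiK).
have m20 : 0 < m ^+ 2 by rewrite exprn_gt0.
have psim : \int[theta]_t psi t = m ^+ 2 by exact: (Rintegral_autocorrelation cphi phi01 cK phiK).
have psi_ge0 t : 0 <= psi t by exact: autocorrelation_ge0.
have cpsi : continuous psi by exact: (continuous_autocorrelation hausG haar cphi phi01 phi0 cK phiK).
have ipsi : theta.-integrable setT (fun t => (psi t)%:E).
  apply/integrableP; split; first by apply/measurable_EFinP; exact: continuous_borel.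
  rewrite (eq_integral (fun t : borel (at_zero G) => (psi t)%:E)); last first.
    by move=> t _; rewrite gee0_abs// lee_fin.
  (* An infinite integral would be sent to 0 by [fine], whereas the real integral of [psi] is
     [m ^+ 2 > 0]. *)
  rewrite ltey; apply/eqP => psioo.
  by move: m20; rewrite -psim /Rintegral psioo /= ltxx.
have psiU t : psi t != 0 -> U t.
  move=> /autocorrelation_support[r [s [/phiWK[[Wr _] _] /phiWK[[Ws _] _] ->]]].
  exact: WU.
have psih_close t : `|psi t * complex.Re (h t) - h0 * psi t| <= e * psi t.
  rewrite mulrC -mulrBl normrM (ger0_norm (psi_ge0 t)).
  have [->|/psiU] := eqVneq (psi t) 0; first by rewrite !mulr0.
  by rewrite /U /= distrC => /ltW ?; rewrite ler_wpM2r.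
have ipsih : theta.-integrable setT (fun t => (psi t * complex.Re (h t))%:E).
  apply: (@integrable_dominated _ (borel (at_zero G)) R theta _ (fun t => (`|h0| + e) * psi t)).
  - apply: (@continuous_borel _ _ (fun t => psi t * complex.Re (h t))) => t.
    by apply: cvgM; [exact: cpsi|exact: cRe].
  - move=> t; rewrite mulrDl -lerBlDl; apply: le_trans (psih_close t).
    by rewrite -(ger0_norm (psi_ge0 t)) -normrM (ger0_norm (psi_ge0 t)) lerB_dist.
  - exact: (integrableZl measurableT (`|h0| + e) ipsi).
(* [J] is estimated twice: [J1] and [J2] use that [Re h] is within [e] of [h0] on the support of
   [psi], [J3] and [J4] use the Fourier transform. *)
set J := \int[theta]_t (psi t * complex.Re (h t)).
have J1 : (h0 - e) * m ^+ 2 <= J.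
  rewrite -psim -RintegralZl//; apply: le_Rintegral => //.
    exact: (integrableZl measurableT (h0 - e) ipsi).
  move=> t _; have := psih_close t; rewrite ler_norml => /andP[+ _].
  by rewrite mulrBl; lra.
have J2 : J <= (h0 + e) * m ^+ 2.
  rewrite -psim -RintegralZl//; apply: le_Rintegral => //.
    exact: (integrableZl measurableT (h0 + e) ipsi).
  move=> t _; have := psih_close t; rewrite ler_norml => /andP[_].
  by rewrite mulrDl; lra.
have J3 := autocorrelation_le hausG haar cphi phi01 cK phiK bS hb.
have e10 : 0 <= 1 - e by rewrite subr_ge0 ltW.
have J4 : ((1 - e) * m) ^+ 2 * (\sum_(chi \in F) cabs (b chi) ^+ 2) <= J.
  apply: (autocorrelation_ge hausG haar cphi phi01 cK phiK hb finF e10).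
  by move=> chi Fchi t /phiWK[[_ Vt] _]; exact: Vt.
split.
  by rewrite -(ler_pM2l m20) mulrC; exact: le_trans J1 J3.
have : (1 - e) ^+ 2 * (\sum_(chi \in F) cabs (b chi) ^+ 2) <= h0 + e.
  rewrite -(ler_pM2l m20) (mulrC _ (h0 + e)); apply: le_trans J2; apply: le_trans J4.
  by rewrite exprMn; lra.
have SFS : \sum_(chi \in F) cabs (b chi) ^+ 2 <= S.
  by apply: esum_finite_le => //; rewrite bS.
(* The constant [2 + 2 * S] comes from [(1 - e)^2 (S - e) >= S - e - 2 e S], valid since [e < 1],
   together with the further loss [e] in [h0 + e]. *)
move: SF SFS; set s := \sum_(_ \in F) _ => SF SFS.
nra.
Qed.

End eberlein_at_zero.

(** * Limits superior and square roots in the extended reals *)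

Section limsup_real_bounds.
Variable R : realType.
Implicit Types (u : nat -> \bar R) (x : \bar R) (a : R).

Lemma limn_esup_lt u a : (limn_esup u < a%:E)%E -> \forall n \near \oo, (u n < a%:E)%E.
Proof.
move=> /ereal_inf_lt[_ [V Voo <-] Va]; apply: filterS Voo => n Vn.
by apply: le_lt_trans Va; apply: ereal_sup_ubound; exists n.
Qed.

Lemma limn_esup_le u a : (\forall n \near \oo, (u n <= a%:E)%E) -> (limn_esup u <= a%:E)%E.
Proof.
move=> ua; apply: (@le_trans _ _ (ereal_sup (u @` [set n | (u n <= a%:E)%E]))).
  by apply: ereal_inf_lbound; exists [set n | (u n <= a%:E)%E].
by apply: ge_ereal_sup => _ [n ? <-].
Qed.

Lemma poweR12_lt x a : (0 <= x)%E -> (x `^ 2^-1 < a%:E)%E -> (x <= (a ^+ 2)%:E)%E.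
Proof.
case: x => [r|//|//]; rewrite ?lee_fin ?lte_fin => r0.
  rewrite powR12_sqrt// => ra; have a0 := le_trans (sqrtr_ge0 r) (ltW ra).
  by rewrite -(sqr_sqrtr r0) ler_sqr ?nnegrE ?sqrtr_ge0// ltW.
by rewrite poweRyr.
Qed.

Lemma poweR12_le x a : (0 <= x)%E -> 0 <= a -> (x <= (a ^+ 2)%:E)%E ->
  (x `^ 2^-1 <= a%:E)%E.
Proof.
case: x => [r|//|//]; rewrite ?lee_fin => r0 a0 ra.
by rewrite powR12_sqrt// -(ger0_norm a0) -sqrtr_sqr ler_wsqrtr.
Qed.

End limsup_real_bounds.

(** * Quadratic means along the van Hove sequence *)

Section averages.
Variables (R : realType) (G : topologicalZmodType).
Variable theta : {measure set (borel (at_zero G)) -> \bar R}.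
Hypothesis haar : is_haar_measure theta.
Variable A : nat -> set G.
Hypothesis vhA : van_hove theta A.

Let mA n : measurable (A n : set (borel (at_zero G))).
Proof. by case: vhA => /(_ n)[oA _ _] _; exact: borel_open. Qed.

Let Aoo n : (theta (A n) < +oo)%E.
Proof.
case: vhA => /(_ n)[oA pA _] _; case: haar => _ Koo _ _ _.
move: pA; rewrite precompactE => cA; apply: le_lt_trans (Koo _ cA).
apply: le_measure; rewrite ?inE//; last exact: subset_closure.
exact: (borel_closed (@closed_closure _ (A n))).
Qed.

Lemma vol_gt0 n : 0 < vol theta (A n).
Proof. by case: vhA => /(_ n)[_ _ A0] _; rewrite fine_gt0// A0 Aoo. Qed.

Let volK n : (vol theta (A n))^-1 * vol theta (A n) = 1.
Proof. by rewrite mulVf ?gt_eqF ?vol_gt0. Qed.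

(** Real-valued, so that means can be subtracted; for [square_integrable] functions it agrees with
    the extended-real mean inside [besicovitch_norm]. *)
Definition square_mean (f : G -> cplx R) (n : nat) : R :=
  (vol theta (A n))^-1 * \int[theta]_(t in A n) (cabs (f t) ^+ 2).

Definition square_integrable (f : G -> cplx R) := forall n,
  theta.-integrable (A n) (fun t => (cabs (f t) ^+ 2)%:E).

(** At the shift [t = 0] the integrand [f(s) conj(f(s - t))] is [|f(s)|^2]. *)
Lemma eberlein_square_mean (f h : G -> cplx R) : is_reflected_eberlein theta A f h ->
  square_integrable f /\ square_mean f @ \oo --> complex.Re (h 0).
Proof.
move=> /(_ 0)[fi fh].
have Ref t : complex.Re (f t * conjc (f (t - 0))) = cabs (f t) ^+ 2.
  by rewrite subr0 cabs_sqr; case: (f t) => x y /=; rewrite mulrN opprK -!expr2.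
split=> [n|].
  have [+ _] := fi n; apply: eq_integrable => // t _; first by rewrite Ref.
rewrite (_ : square_mean f = fun n =>
    complex.Re (average theta A (fun s => f s * conjc (f (s - 0))) n)).
  exact: (continuous_cvg _ (@continuous_Re R (h 0)) fh).
apply/funext => n; rewrite /square_mean /average /cintegral /= mul0r subr0; congr (_ * _).
by apply: eq_Rintegral => t _; rewrite Ref.
Qed.

Lemma average1 n : average theta A (fun=> 1 : cplx R) n = 1.
Proof.
rewrite /average /cintegral !(Rintegral_cst _ (mA n)) /= mul1r mul0r.
rewrite -[RHS](_ : (1 : R)%:C = 1) // -(volK n).
by apply/eqP; rewrite eq_complex /= !mulr0 !mul0r subr0 addr0 !eqxx.
Qed.

Lemma besicovitch_norm_lim (f : G -> cplx R) (s : R) : square_integrable f ->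
  square_mean f @ \oo --> s -> besicovitch_norm theta A f = (Num.sqrt s)%:E.
Proof.
move=> fi fs; rewrite /besicovitch_norm.
have -> : (fun n => ((((vol theta (A n))^-1)%:E *
    \int[theta]_(t in A n) (cabs (f t) ^+ 2)%:E) `^ (2^-1))%E) =
    (fun n => (Num.sqrt (square_mean f n))%:E).
  apply/funext => n; rewrite -powR12_sqrt; last first.
    apply: mulr_ge0; first by rewrite invr_ge0 ltW// vol_gt0.
    by apply: Rintegral_ge0 => t _; exact: sqr_ge0.
  rewrite -poweR_EFin EFinM; congr ((_ * _) `^ _)%E.
  by rewrite /Rintegral fineK//; exact: (integrable_fin_num (mA n) (fi n)).
suff /cvg_limn_einf_sup[_ ->] : (fun n => (Num.sqrt (square_mean f n))%:E) @ \oo -->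
    (Num.sqrt s)%:E by [].
apply/fine_cvgP; split; first exact: nearW.
exact: (continuous_cvg _ (@sqrt_continuous R s) fs).
Qed.

Let msq (f : G -> cplx R) n : cmeasurable [set: borel (at_zero G)] f ->
  measurable_fun (A n : set (borel (at_zero G))) (fun t => (cabs (f t) ^+ 2)%:E).
Proof.
move=> [mr mi]; apply/measurable_EFinP; apply: measurable_funTS.
rewrite (_ : (fun t => _) =
  (fun t => complex.Re (f t) ^+ 2 + complex.Im (f t) ^+ 2)); last first.
  by apply/funext => t; rewrite cabs_sqr.
by apply: measurable_funD; exact: measurable_funX.
Qed.

Lemma cmeasurableD (f g : G -> cplx R) :
  cmeasurable [set: borel (at_zero G)] f -> cmeasurable [set: borel (at_zero G)] g ->
  cmeasurable [set: borel (at_zero G)] (f + g)%R.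
Proof.
move=> [fr fi] [gr gi]; split.
  rewrite (_ : (fun t => _) = (fun t => complex.Re (f t) + complex.Re (g t))).
    exact: measurable_funD.
  by apply/funext => t /=; rewrite raddfD.
rewrite (_ : (fun t => _) = (fun t => complex.Im (f t) + complex.Im (g t))).
  exact: measurable_funD.
by apply/funext => t /=; rewrite raddfD.
Qed.

Lemma cmeasurableB (f g : G -> cplx R) :
  cmeasurable [set: borel (at_zero G)] f -> cmeasurable [set: borel (at_zero G)] g ->
  cmeasurable [set: borel (at_zero G)] (f - g)%R.
Proof.
move=> [fr fi] [gr gi]; split.
  rewrite (_ : (fun t => _) = (fun t => complex.Re (f t) - complex.Re (g t))).
    exact: measurable_funB.
  by apply/funext => t /=; rewrite raddfB.
rewrite (_ : (fun t => _) = (fun t => complex.Im (f t) - complex.Im (g t))).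
  exact: measurable_funB.
by apply/funext => t /=; rewrite raddfB.
Qed.

(** Parallelogram law: the two sides differ by [|z - w|^2]. *)
Lemma cabs_sqrD_le (z w : R[i]) : cabs (z + w) ^+ 2 <= 2 * cabs z ^+ 2 + 2 * cabs w ^+ 2.
Proof.
rewrite !cabs_sqr !raddfD /=.
move: (complex.Re z) (complex.Im z) (complex.Re w) (complex.Im w) => p q r s.
rewrite -subr_ge0.
have -> : 2 * (p ^+ 2 + q ^+ 2) + 2 * (r ^+ 2 + s ^+ 2) -
  ((p + r) ^+ 2 + (q + s) ^+ 2) = (p - r) ^+ 2 + (q - s) ^+ 2 by ring.
by rewrite addr_ge0 ?sqr_ge0.
Qed.

Lemma besicovitch_norm_ge0 (f : G -> cplx R) : (0 <= besicovitch_norm theta A f)%E.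
Proof.
by apply: limf_esup_ge0 => [|n]; [exact: filter_not_empty|exact: poweR_ge0].
Qed.

(* The constant 2 comes from [|z + w|^2 <= 2 |z|^2 + 2 |w|^2]; Minkowski's
   inequality would remove it. *)
Lemma besicovitch_normD_le (f g : G -> cplx R) (a b : R) :
  cmeasurable [set: borel (at_zero G)] f -> cmeasurable [set: borel (at_zero G)] g ->
  (besicovitch_norm theta A f < a%:E)%E -> (besicovitch_norm theta A g < b%:E)%E ->
  (besicovitch_norm theta A (f + g)%R <= (2 * a + 2 * b)%:E)%E.
Proof.
move=> mf mg fa gb.
have a0 : 0 <= a by rewrite -lee_fin (le_trans (besicovitch_norm_ge0 f))// ltW.
have b0 : 0 <= b by rewrite -lee_fin (le_trans (besicovitch_norm_ge0 g))// ltW.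
apply: limn_esup_le; near=> n.
have : (((((vol theta (A n))^-1)%:E * \int[theta]_(t in A n) (cabs (f t) ^+ 2)%:E)
   `^ (2^-1)) < a%:E)%E by near: n; exact: limn_esup_lt.
have : (((((vol theta (A n))^-1)%:E * \int[theta]_(t in A n) (cabs (g t) ^+ 2)%:E)
   `^ (2^-1)) < b%:E)%E by near: n; exact: limn_esup_lt.
have v0 : (0 <= ((vol theta (A n))^-1)%:E)%E by rewrite lee_fin invr_ge0 ltW ?vol_gt0.
have int0 (k : G -> cplx R) : (0 <= \int[theta]_(t in A n) (cabs (k t) ^+ 2)%:E)%E.
  by apply: integral_ge0 => t _; rewrite lee_fin sqr_ge0.
move=> /(poweR12_lt (mule_ge0 v0 (int0 g))) gb' /(poweR12_lt (mule_ge0 v0 (int0 f))) fa'.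
apply: poweR12_le; [exact: mule_ge0|by rewrite addr_ge0 ?mulr_ge0|].
have : (\int[theta]_(t in A n) (cabs ((f + g) t) ^+ 2)%:E <=
    2%:E * \int[theta]_(t in A n) (cabs (f t) ^+ 2)%:E +
    2%:E * \int[theta]_(t in A n) (cabs (g t) ^+ 2)%:E)%E.
  have sq0 (k : G -> cplx R) t : A n t -> (0 <= (cabs (k t) ^+ 2)%:E)%E.
    by move=> _; rewrite lee_fin sqr_ge0.
  have sq20 (k : G -> cplx R) t : A n t -> (0 <= 2%:E * (cabs (k t) ^+ 2)%:E)%E.
    by move=> _; rewrite -EFinM lee_fin mulr_ge0// sqr_ge0.
  have m2 (k : G -> cplx R) : cmeasurable [set: borel (at_zero G)] k ->
      measurable_fun (A n : set (borel (at_zero G)))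
        (fun t => 2%:E * (cabs (k t) ^+ 2)%:E)%E.
    by move=> mk; apply: measurable_funeM; exact: msq.
  rewrite -!ge0_integralZl//; try exact: sq0; try exact: msq.
  rewrite -ge0_integralD//; try exact: sq20; try exact: m2.
  apply: ge0_le_integral => //.
  - exact: sq0.
  - by apply: msq; exact: cmeasurableD.
  - by apply: emeasurable_funD; exact: m2.
  - by move=> t _; rewrite lee_fin; exact: cabs_sqrD_le.
move=> /(lee_wpmul2l v0)/le_trans; apply.
rewrite ge0_muleDr ?mule_ge0// !(muleCA _ 2%:E).
apply: (@le_trans _ _ (2%:E * (a ^+ 2)%:E + 2%:E * (b ^+ 2)%:E)%E).
  by apply: leeD; apply: lee_wpmul2l.
rewrite -!EFinM -EFinD lee_fin.
by have := mulr_ge0 a0 b0; have := sqr_ge0 a; have := sqr_ge0 b; nra.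
Unshelve. all: by end_near. Qed.

Lemma besicovitch_normN (f : G -> cplx R) :
  besicovitch_norm theta A (- f)%R = besicovitch_norm theta A f.
Proof.
rewrite /besicovitch_norm; congr limn_esup; apply/funext => n.
congr ((_ * _) `^ _)%E; apply: eq_integral => t _.
by rewrite !cabs_sqr /= !raddfN !sqrrN.
Qed.

(** Polarization for means. The cross term is rewritten through [|f + g|^2], [|f|^2] and 1, whose
    integrability is at hand, and only then integrated. *)
Lemma square_meanD_unimodular (f g : G -> cplx R) n :
  (forall t, cabs (g t) = 1) -> square_integrable f ->
  square_integrable (f + g)%R ->
  square_mean (f + g)%R n = square_mean f n + 1 +
    2 * ((vol theta (A n))^-1 *
      \int[theta]_(t in A n) complex.Re (conjc (g t) * f t)).
Proof.
move=> g1 fi fgi.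
have i1 : theta.-integrable (A n : set (borel (at_zero G))) (fun=> 1%:E).
  apply/integrableP; split => //.
  rewrite (eq_integral (cst 1%E)); last by move=> t _; rewrite gee0_abs.
  by rewrite integral_cst// mul1e.
have idiff : theta.-integrable (A n) (fun t => (cabs ((f + g)%R t) ^+ 2 - cabs (f t) ^+ 2)%:E).
  exact: (integrableB (mA n) (fgi n) (fi n)).
have idiff1 : theta.-integrable (A n) (fun t => (cabs ((f + g)%R t) ^+ 2 - cabs (f t) ^+ 2 - 1)%:E).
  exact: (integrableB (mA n) idiff i1).
have -> : \int[theta]_(t in A n) complex.Re (conjc (g t) * f t) =
    \int[theta]_(t in A n) (2^-1 * (cabs ((f + g)%R t) ^+ 2 - cabs (f t) ^+ 2 - 1)).
  apply: eq_Rintegral => t _.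
  have : cabs (g t) ^+ 2 = 1 by rewrite g1 expr1n.
  rewrite (_ : (f + g) t = f t + g t)// !cabs_sqr; case: (f t) (g t) => [p q] [r s] /= rs1.
  rewrite -[X in _ * (_ - X)]rs1; by field.
rewrite (RintegralZl 2^-1 (mA n) idiff1) (RintegralB (mA n) idiff i1) (RintegralB (mA n) (fgi n) (fi n)).
rewrite (Rintegral_cst _ (mA n)).
rewrite /square_mean -/(vol theta (A n)) mul1r.
move: (volK n); set v := vol _ _; move: (v^-1) => w wv.
have -> : w * (2^-1 * (\int[theta]_(t in A n) (cabs ((f + g)%R t) ^+ 2)
     - \int[theta]_(t in A n) (cabs (f t) ^+ 2) - v)) =
  2^-1 * (w * \int[theta]_(t in A n) (cabs ((f + g)%R t) ^+ 2)
     - w * \int[theta]_(t in A n) (cabs (f t) ^+ 2) - w * v) by ring.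
by rewrite wv; field.
Qed.

End averages.

(** The sum over the points other than [x] is common to both families and finite, so it cancels. *)
Lemma esum_update (R : realType) (T : choiceType) (x : T) (u v : T -> R) (U V : R) :
  (forall y, 0 <= u y) -> (forall y, 0 <= v y) -> (forall y, y != x -> u y = v y) ->
  (\esum_(y in [set: T]) (u y)%:E = U%:E)%E ->
  (\esum_(y in [set: T]) (v y)%:E = V%:E)%E -> V = U + v x - u x.
Proof.
move=> u0 v0 uv.
have split_x (w : T -> R) : (forall y, 0 <= w y) ->
    (\esum_(y in [set: T]) (w y)%:E =
     \esum_(y in [set x]) (w y)%:E + \esum_(y in ~` [set x]) (w y)%:E)%E.
  by move=> w0; rewrite (esumID [set x]) ?setTI// => y _; rewrite lee_fin.
rewrite !split_x//.
rewrite !esum_set1 ?lee_fin//.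
have -> : (\esum_(y in ~` [set x]) (v y)%:E = \esum_(y in ~` [set x]) (u y)%:E)%E.
  by apply: eq_esum => y /= /eqP yx; rewrite uv.
case: (esum _ _) => [r| |]//; rewrite -!EFinD => -[<-] [<-]; ring.
Qed.

(** * Expansions, seminorm and Besicovitch norm on [C] *)

Section expansions.
Variables (R : realType) (G : topologicalZmodType).
Hypothesis hausG : hausdorff_space G.
Hypothesis lcG : locally_compact [set: G].
Variable theta : {measure set (borel (at_zero G)) -> \bar R}.
Hypothesis haar : is_haar_measure theta.
Variable A : nat -> set G.
Hypothesis vhA : van_hove theta A.
Variable C : set (G -> cplx R).
Hypotheses (subC : linear_subspace C) (CL2 : C `<=` L2loc theta).
Variable N : (G -> cplx R) -> R.
Hypothesis N_ge0 : forall f, C f -> 0 <= N f.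
Variable c : (G -> cplx R) -> dual R G -> R[i].
Hypothesis Na : forall f, C f ->
  ((N f ^+ 2)%:E = \esum_(chi in setT) (cabs (c f chi) ^+ 2)%:E)%E.
Hypothesis charb : forall chi : dual R G,
  C chi /\ forall xi : dual R G, c chi xi = (xi == chi)%:R.
Hypothesis linc : forall (a : R[i]) (f g : G -> cplx R), C f -> C g ->
  forall chi, c (a *: f + g) chi = a * c f chi + c g chi.
Hypothesis fourierd : forall f, C f ->
  exists h : G -> cplx R,
    [/\ is_reflected_eberlein theta A f h, continuous h &
        is_fourier_transform theta (density_measure theta h)
          (sq_atomic (c f : borel (dual R G) -> R[i]))].

Lemma C0 : C 0. Proof. by case: subC. Qed.

Lemma CZD a f g : C f -> C g -> C (a *: f + g).
Proof. by case: subC => _; apply. Qed.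

Lemma coefficient0 chi : c 0 chi = 0.
Proof.
have := linc (-1) C0 C0 chi; rewrite scaler0 addr0 mulN1r addNr; exact.
Qed.

Lemma CB f g : C f -> C g -> C (f - g).
Proof. by move=> Cf Cg; rewrite addrC -scaleN1r; exact: CZD. Qed.

Lemma coefficientB f g chi : C f -> C g -> c (f - g) chi = c f chi - c g chi.
Proof.
by move=> Cf Cg; rewrite addrC -scaleN1r linc// mulN1r addrC.
Qed.

(** The characters [chi i] may repeat, so the coefficient at [xi] collects every [a i] with
    [chi i = xi]. *)
Lemma trigonometric_polynomial_expansion n (a : 'I_n -> R[i]) (chi : 'I_n -> dual R G) :
  let P := (fun t => \sum_(i < n) a i * chi i t) : G -> cplx R in
  C P /\ forall xi, c P xi = \sum_(i < n) a i * (xi == chi i)%:R.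
Proof.
elim: n a chi => [|n IH] a chi P.
  have -> : P = 0 by apply/funext => t; rewrite /P big_ord0.
  by split=> [|xi]; [exact: C0|rewrite coefficient0 big_ord0].
have [CQ cQ] := IH (fun i => a (lift ord0 i)) (fun i => chi (lift ord0 i)).
set Q : G -> cplx R := (fun t => _) in CQ cQ.
have [Cchi cchi] := charb (chi ord0).
have -> : P = a ord0 *: (chi ord0 : G -> cplx R) + Q.
  by apply/funext => t; rewrite /P big_ord_recl.
split=> [|xi]; first exact: CZD.
by rewrite linc// cchi cQ big_ord_recl.
Qed.

(** The constant 1 is a character, hence in [C]; its averages are all 1, so its Eberlein convolution
    is 1 and the associated measure is [theta] itself. *)
Lemma fourier_trivial_character :
  is_fourier_transform theta (density_measure theta (fun=> 1))
  (sq_atomic (fun xi : borel (dual R G) => (xi == trivial_character R G :> dual R G)%:R : R[i])).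
Proof.
have [C1 c1] := charb (trivial_character R G).
have [h [eh _ fh]] := fourierd C1.
have h1 : h = fun=> 1.
  apply/funext => t; have [_ avh] := eh t.
  apply: (cvg_unique (@norm_hausdorff _ (cplx R)) avh).
  rewrite (_ : average _ _ _ = fun=> 1); first exact: cvg_cst.
  apply/funext => n; rewrite -[RHS](average1 haar vhA n); congr average.
  by apply/funext => s; rewrite [LHS]mul1r; exact: conjc1.
have <- : (c (trivial_character R G) : borel (dual R G) -> R[i]) =
  (fun xi : borel (dual R G) => (xi == trivial_character R G :> dual R G)%:R : R[i]).
  by apply/funext => xi; exact: c1.
by rewrite -h1.
Qed.

Lemma square_mean_cvg f : C f ->
  square_integrable theta A f /\ square_mean theta A f @ \oo --> N f ^+ 2.
Proof.
move=> Cf; have [h [eh ch fh]] := fourierd Cf.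
rewrite -(eberlein_at_zero hausG lcG haar fourier_trivial_character ch (esym (Na Cf)) fh).
exact: eberlein_square_mean.
Qed.

Lemma norm_besicovitch f : C f -> (N f)%:E = besicovitch_norm theta A f.
Proof.
move=> Cf; have [fi fs] := square_mean_cvg Cf.
by rewrite (besicovitch_norm_lim haar vhA fi fs) sqrtr_sqr ger0_norm// N_ge0.
Qed.

(** [P] is the partial sum over a finite [F] carrying all but [e ^+ 2] of the square sum. The
    coefficients of [f - P] are those of [f] outside [F], whence [N (f - P) < e]. *)
Lemma trigonometric_approx f (e : R) : C f -> 0 < e ->
  exists2 P, trigonometric_polynomial P & (besicovitch_norm theta A (f - P)%R < e%:E)%E.
Proof.
move=> Cf e0; have e20 : 0 < e ^+ 2 by rewrite exprn_gt0.
have [F finF NF] := esum_finite_approx (esym (Na Cf)) e20.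
have /finite_fsetP[D FD] := finF.
pose s := finmap.enum_fset D.
(* [x0] is a mere default for [nth], never reached because the indices stay below [size s]. *)
pose x0 := trivial_character R G.
pose chi (i : 'I_(size s)) := nth x0 s i.
have [CP cP] := trigonometric_polynomial_expansion (fun i => c f (chi i)) chi.
set P : G -> cplx R := (fun t => _) in CP cP.
exists P; first by exists (size s), (fun i => c f (chi i)), chi.
have cPF xi : c P xi = if xi \in F then c f xi else 0.
  rewrite cP.
  transitivity (\sum_(y <- s) c f y * (xi == y)%:R).
    by rewrite (big_nth x0) big_mkord.
  rewrite FD; case: ifPn => [|]; rewrite ?notin_setE ?inE /= => xiD.
    rewrite (bigD1_seq xi)//= ?finmap.fset_uniq// eqxx mulr1 big1 ?addr0// => y yx.
    by rewrite eq_sym (negbTE yx) mulr0.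
  rewrite big_seq big1// => y yD; have [xy|] := eqVneq xi y; last by rewrite mulr0.
  by move: xiD; rewrite xy.
have CfP := CB Cf CP.
rewrite -norm_besicovitch// lte_fin -ltr_sqr ?nnegrE ?N_ge0 ?ltW//.
have : (N (f - P) ^+ 2)%:E = (\esum_(xi in ~` F) (cabs (c f xi) ^+ 2)%:E)%E.
  rewrite Na// [RHS]esum_mkcond; apply: eq_esum => xi _.
  rewrite coefficientB// cPF in_setC; case: ifPn => /= _; last by rewrite subr0.
  by rewrite subrr /cabs Normc.normc0 expr0n.
have sq0 xi : (0 <= (cabs (c f xi) ^+ 2)%:E)%E by rewrite lee_fin sqr_ge0.
have := Na Cf; rewrite (esumID F)// setTI (_ : setT `&` _ = ~` F) ?setTI//.
rewrite esum_fset// fsumEFin// => NE NfP; move: NE; rewrite -NfP -EFinD => -[NE].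
by move: NF; rewrite NE; lra.
Qed.

(** * Fourier-Bohr coefficients by polarization *)

(** Adding [a *: chi] changes the coefficient at [chi] only, and
    [|a + z|^2 = |z|^2 + 1 + 2 Re (conj(a) z)] for [|a| = 1]. *)
Lemma norm_unimodular_shift f (a : R[i]) (chi : dual R G) : C f -> cabs a = 1 ->
  N (a *: (chi : G -> cplx R) + f) ^+ 2 =
  N f ^+ 2 + 1 + 2 * complex.Re (conjc a * c f chi).
Proof.
move=> Cf a1; have [Cchi cchi] := charb chi.
have Cg := CZD a Cchi Cf.
have cg xi : c (a *: (chi : G -> cplx R) + f) xi = a * (xi == chi)%:R + c f xi.
  by rewrite linc// cchi.
have agree xi : xi != chi -> cabs (c f xi) ^+ 2 =
    cabs (c (a *: (chi : G -> cplx R) + f) xi) ^+ 2.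
  by move=> /negbTE xichi; rewrite cg xichi mulr0 add0r.
rewrite (esum_update (fun xi => sqr_ge0 _) (fun xi => sqr_ge0 _) agree
  (esym (Na Cf)) (esym (Na Cg))) cg eqxx mulr1.
have : cabs a ^+ 2 = 1 by rewrite a1 expr1n.
rewrite !cabs_sqr; case: (a) (c f chi) => [p q] [r s] /= pq1.
by rewrite -[X in _ = _ + X + _]pq1; ring.
Qed.

(** The same polarization identity holds for the means and for the coefficients, and the square
    means of [f] and of [a *: chi + f] converge to the squared seminorms. *)
Lemma Re_average_cvg f (a : R[i]) (chi : dual R G) : C f -> cabs a = 1 ->
  (fun n => (vol theta (A n))^-1 *
     \int[theta]_(t in A n) complex.Re (conjc (a * chi t) * f t)) @ \oo -->
  complex.Re (conjc a * c f chi).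
Proof.
move=> Cf a1; have [Cchi _] := charb chi; have [_ _ chi1] := dual_funP chi.
have [fi fs] := square_mean_cvg Cf.
have [gi gs] := square_mean_cvg (CZD a Cchi Cf).
set g := a *: _ + f in gi gs.
have gE : g = f + (fun t => a * chi t) by rewrite /g addrC.
have u1 t : cabs (a * chi t) = 1 by rewrite /cabs Normc.normcM [X in X * _]a1 mul1r; exact: chi1.
have -> : complex.Re (conjc a * c f chi) = 2^-1 * (N g ^+ 2 - N f ^+ 2 - 1).
  by rewrite norm_unimodular_shift//; field.
have meanE n : (vol theta (A n))^-1 *
     \int[theta]_(t in A n) complex.Re (conjc (a * chi t) * f t) =
  2^-1 * (square_mean theta A g n - square_mean theta A f n - 1).
  rewrite gE in gi *; rewrite (square_meanD_unimodular haar vhA n u1 fi gi).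
  by set I := _^-1 * _; field.
under eq_fun do rewrite meanE.
apply: cvgMr; apply: cvgB; last exact: cvg_cst.
exact: cvgB.
Qed.

(** Taking [a = 1] yields the real part, and [a = 'i] the imaginary part, since
    [Re (conj('i) z) = Im z]. *)
Lemma fourier_bohr f (chi : dual R G) : C f ->
  is_fourier_bohr_coef theta A f chi (c f chi).
Proof.
move=> Cf; have cabs1 : cabs (1 : R[i]) = 1 by exact: Normc.normc1.
have cabsi : cabs ('i : R[i]) = 1.
  by rewrite /cabs /= expr0n expr1n add0r sqrtr1.
apply: cvg_complex.
  have := Re_average_cvg (chi := chi) Cf cabs1.
  rewrite (_ : complex.Re (conjc 1 * c f chi) = complex.Re (c f chi)); last first.
    by rewrite conjc1 mul1r.
  rewrite (_ : (fun n => _) = fun n =>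
    complex.Re (average theta A (fun t => conjc (chi t) * f t) n)); first exact.
  apply/funext => n; rewrite /average /cintegral /= mul0r subr0; congr (_ * _).
  by apply: eq_Rintegral => t _; rewrite mul1r.
have := Re_average_cvg (chi := chi) Cf cabsi.
rewrite (_ : complex.Re (conjc 'i * c f chi) = complex.Im (c f chi)); last first.
  by case: (c f chi) => p q /=; ring.
rewrite (_ : (fun n => _) = fun n =>
  complex.Im (average theta A (fun t => conjc (chi t) * f t) n)); first exact.
apply/funext => n; rewrite /average /cintegral /= mul0r addr0; congr (_ * _).
apply: eq_Rintegral => t _.
by case: (dual_fun chi t) (f t) => [p q] [r s] /=; ring.
Qed.


(** * Completeness under the Riesz-Fischer condition *)

Lemma trigonometric_polynomial_C P : trigonometric_polynomial P -> C P.
Proof.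
by move=> [n [a [chi ->]]]; exact: (trigonometric_polynomial_expansion a chi).1.
Qed.

Lemma finite_coefficients_le f (F : set (dual R G)) : C f -> finite_set F ->
  \sum_(chi \in F) cabs (c f chi) ^+ 2 <= N f ^+ 2.
Proof. by move=> Cf finF; apply: esum_finite_le => //; rewrite Na. Qed.

Lemma cabs_coefficient_le f chi : C f -> cabs (c f chi) <= N f.
Proof.
move=> Cf; rewrite -ler_sqr ?nnegrE ?cabs_ge0 ?N_ge0//.
by have := finite_coefficients_le Cf (finite_set1 chi); rewrite fsbig_set1.
Qed.

Let eps (k : nat) : R := k.+1%:R^-1.

Let eps_gt0 k : 0 < eps k. Proof. by rewrite invr_gt0. Qed.

Let eps_le k l : (k <= l)%N -> eps l <= eps k.
Proof. by move=> kl; rewrite lef_pV2 ?posrE// ler_nat. Qed.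

Let eps_small (e : R) : 0 < e -> exists k, eps k < e.
Proof.
move=> e0; have := @near_infty_natSinv_lt R (PosNum e0).
by move=> [k _ /(_ k (leqnn k))] ?; exists k.
Qed.

Lemma cvg_of_eps_dist (u : nat -> R) (M : R) : 0 < M ->
  (forall k l, (k <= l)%N -> `|u k - u l| <= M * eps k) -> exists x : R, u @ \oo --> x.
Proof.
move=> M0 uM; apply/cvg_ex/cauchy_cvgP/cauchy_exP => e e0.
have [K KM] := eps_small (divr_gt0 e0 M0).
exists (u K); exists K => // l /= Kl; apply: le_lt_trans (uM _ _ Kl) _.
by rewrite mulrC -ltr_pdivlMr.
Qed.

(** The completeness proof for l^2, run on the coefficients of approximating polynomials; the
    Riesz-Fischer condition realizes the limit family by some [g] in [C]. *)
Lemma besicovitch_riesz_fischer f :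
  (forall b : dual R G -> R[i],
      (\esum_(chi in setT) (cabs (b chi) ^+ 2)%:E < +oo)%E ->
      exists2 f, C f & forall chi, c f chi = b chi) ->
  besicovitch_ap theta A f ->
  exists2 g, C g & besicovitch_norm theta A (f - g)%R = 0%E.
Proof.
move=> RF [[mf _] fap].
have mC g : C g -> cmeasurable [set: borel (at_zero G)] g by move=> /CL2[].
have /choice[P PP] : forall k, exists P, trigonometric_polynomial P /\
    (besicovitch_norm theta A (f - P)%R < (eps k)%:E)%E.
  by move=> k; have [P ? ?] := fap _ (eps_gt0 k); exists P.
have CP k : C (P k) by exact: (trigonometric_polynomial_C (PP k).1).
have fP k : (besicovitch_norm theta A (f - P k)%R < (eps k)%:E)%E := (PP k).2.
have mfP k : cmeasurable [set: borel (at_zero G)] (f - P k)%R.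
  by apply: cmeasurableB => //; exact: mC.
(* The triangle inequality with factor 2 gives [2 * eps l + 2 * eps k], and [eps] is
   nonincreasing. *)
have NP k l : (k <= l)%N -> N (P k - P l) <= 4 * eps k.
  move=> kl; rewrite -lee_fin norm_besicovitch; last exact: CB.
  rewrite (_ : P k - P l = (f - P l) - (f - P k)); last first.
    by rewrite opprB [RHS]addrC addrA subrK.
  apply: (@le_trans _ _ (2 * eps l + 2 * eps k)%:E).
    apply: (besicovitch_normD_le haar vhA) => //.
      rewrite -sub0r; apply: cmeasurableB => //; exact: mC C0.
    by rewrite besicovitch_normN.
  by rewrite lee_fin; have := eps_le kl; lra.
have dist k l chi : (k <= l)%N -> cabs (c (P k) chi - c (P l) chi) <= 4 * eps k.
  move=> kl; rewrite -coefficientB//; apply: le_trans (NP _ _ kl).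
  by apply: cabs_coefficient_le; exact: CB.
(* By [dist] the coefficients at each [chi] form a Cauchy sequence; [b] collects their limits. *)
have /choice[p cvp] : forall chi, exists p : R, (fun k => complex.Re (c (P k) chi)) @ \oo --> p.
  move=> chi; apply: (@cvg_of_eps_dist _ 4) => // k l kl.
  by rewrite -raddfB; apply: le_trans (ler_Re_cabs _) (dist _ _ _ kl).
have /choice[q cvq] : forall chi, exists q : R, (fun k => complex.Im (c (P k) chi)) @ \oo --> q.
  move=> chi; apply: (@cvg_of_eps_dist _ 4) => // k l kl.
  by rewrite -raddfB; apply: le_trans (ler_Im_cabs _) (dist _ _ _ kl).
pose b chi : R[i] := p chi +i* q chi.
(* Fatou's argument for sums: for finite [F] the limit in [l] can be taken termwise, and the bound
   does not depend on [F]. *)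
have fatou k (F : set (dual R G)) : finite_set F ->
    \sum_(chi \in F) cabs (c (P k) chi - b chi) ^+ 2 <= (4 * eps k) ^+ 2.
  move=> finF.
  have cvterm chi : (fun l => cabs (c (P k) chi - c (P l) chi) ^+ 2) @ \oo -->
      cabs (c (P k) chi - b chi) ^+ 2.
    have cv : (fun l =>
        (complex.Re (c (P k) chi) - complex.Re (c (P l) chi)) ^+ 2 +
        (complex.Im (c (P k) chi) - complex.Im (c (P l) chi)) ^+ 2) @ \oo -->
        (complex.Re (c (P k) chi) - p chi) ^+ 2 + (complex.Im (c (P k) chi) - q chi) ^+ 2.
      by apply: cvgD; apply: cvgM; apply: cvgB;
        (exact: cvg_cst || exact: cvp || exact: cvq).
    rewrite cabs_sqr !raddfB; under eq_fun do rewrite cabs_sqr !raddfB; exact: cv.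
  have cvF : (fun l => \sum_(chi \in F) cabs (c (P k) chi - c (P l) chi) ^+ 2) @ \oo -->
      \sum_(chi \in F) cabs (c (P k) chi - b chi) ^+ 2.
    rewrite fsbig_finite//=; under eq_fun do rewrite fsbig_finite//=.
    by apply: cvg_big => [|chi _]; [exact: add_continuous|exact: cvterm].
  rewrite -(cvg_lim _ cvF)//; apply: limr_le; first by apply/cvg_ex; eexists; exact: cvF.
  exists k => // l /= kl.
  rewrite (_ : \sum_(chi \in F) _ =
      \sum_(chi \in F) cabs (c (P k - P l) chi) ^+ 2); last first.
    by apply: eq_fsbigr => chi _; rewrite coefficientB.
  apply: (le_trans (finite_coefficients_le (CB (CP k) (CP l)) finF)).
  have e40 : 0 <= 4 * eps k by rewrite mulr_ge0// ltW.
  by rewrite ler_sqr ?nnegrE ?NP//; apply: N_ge0; exact: CB.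
(* Square summability of [b] follows by writing it as [(b - c (P 0)) + c (P 0)]. *)
have bfin : (\esum_(chi in setT) (cabs (b chi) ^+ 2)%:E < +oo)%E.
  apply: (@le_lt_trans _ _ (2 * (4 * eps 0) ^+ 2 + 2 * N (P 0%N) ^+ 2)%:E); last exact: ltry.
  apply: ge_ereal_sup => _ [F [finF _] <-]; rewrite fsumEFin// lee_fin.
  apply: (@le_trans _ _ (2 * (\sum_(chi \in F) cabs (c (P 0%N) chi - b chi) ^+ 2) +
      2 * \sum_(chi \in F) cabs (c (P 0%N) chi) ^+ 2)); last first.
    by apply: lerD; rewrite ler_pM2l//; [exact: fatou|exact: finite_coefficients_le].
  rewrite !fsbig_finite//= !mulr_sumr -big_split/=; apply: ler_sum => chi _.
  have -> : cabs (c (P 0%N) chi - b chi) ^+ 2 = cabs (b chi - c (P 0%N) chi) ^+ 2.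
    by rewrite -opprB !cabs_sqr !raddfN !sqrrN.
  by have := cabs_sqrD_le (b chi - c (P 0%N) chi) (c (P 0%N) chi); rewrite subrK.
have [g Cg cg] := RF b bfin.
have NPg k : N (P k - g) <= 4 * eps k.
  have CPg := CB (CP k) Cg.
  have e40 : 0 <= 4 * eps k by rewrite mulr_ge0// ltW.
  rewrite -ler_sqr ?nnegrE ?N_ge0//.
  rewrite -lee_fin Na//.
  apply: ge_ereal_sup => _ [F [finF _] <-]; rewrite fsumEFin// lee_fin.
  apply: le_trans (fatou k _ finF).
  rewrite (_ : \sum_(chi \in F) _ = \sum_(chi \in F) cabs (c (P k) chi - b chi) ^+ 2)//.
  by apply: eq_fsbigr => chi _; rewrite coefficientB// cg.
exists g => //; apply/eqP; rewrite eq_le besicovitch_norm_ge0 andbT.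
apply/lee_addgt0Pr => e e0; rewrite add0e.
(* 12 is [2 + 2 * 5]: the norm of [f - P k] is below [eps k], and that of [P k - g], at most
   [4 * eps k], is relaxed to 5 for a strict bound. *)
have [k ke] := eps_small (divr_gt0 e0 (ltr0n R 12)).
rewrite (_ : f - g = (f - P k) + (P k - g)); last by rewrite addrA subrK.
apply: (@le_trans _ _ (2 * eps k + 2 * (5 * eps k))%:E).
  apply: (besicovitch_normD_le haar vhA) => //; first by apply: cmeasurableB; exact: mC.
  rewrite -norm_besicovitch ?lte_fin; last exact: CB.
  by apply: (le_lt_trans (NPg k)); have := eps_gt0 k; lra.
by rewrite lee_fin; move: ke; rewrite ltr_pdivlMr//; lra.
Qed.

(** The weak triangle inequality suffices here: bounds [e / 4] on both terms add up to [e]. *)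
Lemma besicovitch_norm0D (f g : G -> cplx R) :
  cmeasurable [set: borel (at_zero G)] f -> cmeasurable [set: borel (at_zero G)] g ->
  besicovitch_norm theta A f = 0%E -> besicovitch_norm theta A g = 0%E ->
  besicovitch_norm theta A (f + g)%R = 0%E.
Proof.
move=> mf mg f0 g0; apply/eqP; rewrite eq_le besicovitch_norm_ge0 andbT.
apply/lee_addgt0Pr => e e0; rewrite add0e.
have e40 : 0 < e / 4 by rewrite divr_gt0.
have -> : e = 2 * (e / 4) + 2 * (e / 4) by field.
by apply: (besicovitch_normD_le haar vhA) => //; rewrite ?f0 ?g0 lte_fin.
Qed.

Lemma besicovitch_class_eq (f g : G -> cplx R) : L2loc theta f -> L2loc theta g ->
  besicovitch_norm theta A (f - g)%R = 0%E ->
  besicovitch_class theta A f = besicovitch_class theta A g.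
Proof.
move=> [mf _] [mg _] fg0.
have mfg := cmeasurableB mf mg.
have mgf := cmeasurableB mg mf.
have gf0 : besicovitch_norm theta A (g - f)%R = 0%E.
  by rewrite -(opprB f g) besicovitch_normN.
apply/seteqP; split=> h [Lh h0]; (split; first exact: Lh); have [mh _] := Lh.
  rewrite (_ : g - h = (g - f) + (f - h)); last by rewrite addrA subrK.
  exact: (besicovitch_norm0D mgf (cmeasurableB mf mh) gf0 h0).
rewrite (_ : f - h = (f - g) + (g - h)); last by rewrite addrA subrK.
exact: (besicovitch_norm0D mfg (cmeasurableB mg mh) fg0 h0).
Qed.

End expansions.

Theorem lemma6p1 (R : realType) (G : topologicalZmodType)
  (hausG : hausdorff_space G) (lcG : locally_compact [set: G])
  (scG : sigma_compact G)
  (theta : {measure set (borel (at_zero G)) -> \bar R}) (haar : is_haar_measure theta)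
  (A : nat -> set G) (vhA : van_hove theta A)
  (C : set (G -> cplx R)) (subC : linear_subspace C) (CL2 : C `<=` L2loc theta)
  (N : (G -> cplx R) -> R) (semiN : seminorm_on C N)
  (c : (G -> cplx R) -> dual R G -> R[i])
  (Na : forall f, C f ->
    ((N f ^+ 2)%:E = \esum_(chi in setT) (cabs (c f chi) ^+ 2)%:E)%E)
  (charb : forall chi : dual R G,
    C chi /\ forall xi : dual R G, c chi xi = (xi == chi)%:R)
  (linc : forall (a : R[i]) (f g : G -> cplx R), C f -> C g ->
    forall chi, c (a *: f + g) chi = a * c f chi + c g chi)
  (fourierd : forall f, C f ->
    exists h : G -> cplx R,
      [/\ is_reflected_eberlein theta A f h, continuous h &
          is_fourier_transform theta (density_measure theta h)
            (sq_atomic (c f : borel (dual R G) -> R[i]))]) :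
  (forall f, C f ->
    [/\ besicovitch_ap theta A f,
        (N f)%:E = besicovitch_norm theta A f &
        forall chi, is_fourier_bohr_coef theta A f chi (c f chi)]) /\
  ((forall b : dual R G -> R[i],
      (\esum_(chi in setT) (cabs (b chi) ^+ 2)%:E < +oo)%E ->
      exists2 f, C f & forall chi, c f chi = b chi) ->
   [set besicovitch_class theta A f | f in C] =
   [set besicovitch_class theta A f | f in besicovitch_ap theta A]).
Proof.
have N_ge0 f : C f -> 0 <= N f by case: semiN => + _ _; exact.
have normB f (Cf : C f) := norm_besicovitch hausG lcG haar vhA N_ge0 Na charb fourierd Cf.
have apC f : C f -> besicovitch_ap theta A f.
  move=> Cf; split; first exact: CL2.
  move=> e e0.
  exact: (trigonometric_approx hausG lcG haar vhA subC N_ge0 Na charb linc fourierd Cf e0).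
split=> [f Cf|RF].
  split; [exact: apC|exact: normB|move=> chi].
  exact: (fourier_bohr hausG lcG haar vhA subC Na charb linc fourierd Cf).
apply/seteqP; split=> _ [f Hf <-]; first by exists f => //; exact: apC.
(* A Besicovitch function is at distance 0 from some [g] in [C], so both define the same class. *)
have [g Cg fg] := besicovitch_riesz_fischer hausG lcG haar vhA subC CL2 N_ge0 Na charb
  linc fourierd RF Hf.
exists g => //; apply/esym.
exact: (besicovitch_class_eq haar vhA Hf.1 (CL2 _ Cg) fg).
Qed.
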